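(* Let $G=(V,E)$ be a finite irreducible directed graph with vertices $v_1,\dots,v_N$ in which every vertex has an incoming edge and an outgoing edge, with $|E|\ge2$, and let $A_G(j,i)$ be the number of edges from $v_j$ to $v_i$. Put $$F_i(w_1,\dots,w_N)=(w_i+1)\sum_{j=1}^N A_G(j,i)(w_j+1),\qquad F_i^n(w_1,\dots,w_N)=F_i(w_1,\dots,w_N)^n .$$ Let $f_i^G(z)=\sum_{n\ge0}c_n^G(i)z^n$ be the generating function of the $G$-Catalan numbers rooted at $v_i$, and $w_i=w_i(z)=f_i^G(z)-1$. Then for every $n\ge1$ and all $i,j=1,\dots,N$, $$c_n^G(i)=\frac{1}{2\pi\sqrt{-1}\,n}\int_C\frac{F_j^n(w_1,\dots,w_N)}{w_j^n}\,dw_i =\frac{1}{2\pi\sqrt{-1}\,n}\int_C\frac{F_j^n(w_1(z),\dots,w_N(z))}{w_j(z)^n}\,w_i'(z)\,dz,$$ where $C$ is a sufficiently small positively oriented simple closed curve around the origin in the complex $z$-plane.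
   Context: Directed graphs may have loops and multiple edges; $G$ is irreducible if for all vertices $u,v$ there is a directed path from $u$ to $v$. For $e\in E$ let $s(e),t(e)$ be its source and terminal vertex. Let $A^G(e,f)=1$ if $t(e)=s(f)$ and $0$ otherwise ($e,f\in E$). $\mathcal{O}_{A^G}$ is the Cuntz-Krieger algebra: the universal $C^*$-algebra generated by partial isometries $S_e$, $e\in E$, with $\sum_{f\in E}S_fS_f^*=1$ and $S_e^*S_e=\sum_{f\in E}A^G(e,f)S_fS_f^*$. For $v\in V$ put $P_v=\sum_{f\in E,\,s(f)=v}S_fS_f^*$. Let $\Sigma_G=\{S_e^*,S_e\mid e\in E\}$ (a set of $2|E|$ symbols). For a word $X=(X_1,\dots,X_{2n})$ in $\Sigma_G$ put $\pi_G(X)=X_1\cdots X_{2n}\in\mathcal{O}_{A^G}$. Let $\Phi_G$ replace each $S_e$ (resp. $S_e^*$) by the canonical isometry indexed by $e$ (resp. its adjoint) in the Cuntz algebra $\mathcal{O}_{|E|}$ generated by isometries $\{\hat S_e\}_{e\in E}$ with $\hat S_e^*\hat S_e=1$, $\sum_e\hat S_e\hat S_e^*=1$. For $n\ge1$, $B_n^G$ is the set of words $X$ of length $2n$ in $\Sigma_G$ with $\pi_G(X)\neq0$ in $\mathcal{O}_{A^G}$ and $\Phi_G(X_1)\cdots\Phi_G(X_{2n})=1$ in $\mathcal{O}_{|E|}$. For each $X\in B_n^G$ there is a unique vertex $v(X)$ with $\pi_G(X)=P_{v(X)}$. Put $c_0^G(i)=1$ and, for $n\ge1$, $c_n^G(i)=|\{X\in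 B_n^G\mid v(X)=v_i\}|$. The power series $f_i^G$ have positive radius of convergence. *)

(* Defs.v *)
From HB Require Import structures.
From mathcomp Require Import all_boot all_order all_algebra.
From mathcomp Require Import all_classical all_reals all_analysis.
From mathcomp Require Import complex.
Import numFieldNormedType.Exports.
Import Order.TTheory GRing.Theory Num.Theory.

Set Implicit Arguments.
Unset Strict Implicit.
Unset Printing Implicit Defensive.

Local Open Scope classical_set_scope.
Local Open Scope ring_scope.

Record digraph := Digraph {
  vertex : finType;
  edge : finType;
  src : edge -> vertex;
  tgt : edge -> vertex }.

Definition adjacent (G : digraph) : rel (vertex G) :=
  fun u v => [exists e : edge G, (src e == u) && (tgt e == v)].

(* [connect] allows the empty path from [u] to [u]; as soon as every vertex
   has an outgoing edge this is the same as requiring nonempty paths. *)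
Definition irreducible (G : digraph) :=
  forall u v : vertex G, connect (@adjacent G) u v.

Definition edge_matrix (G : digraph) (e f : edge G) : nat := tgt e == src f.

Definition vertex_matrix (G : digraph) (u v : vertex G) : nat :=
  #|[set e : edge G | (src e == u) && (tgt e == v)]%SET|.

(* Unital C*-algebras over [R[i]].  The norm is a field of the structure
   because the library's normed modules cannot be joined with its algebras:
   [numDomainType] is already a ring normed over itself.
   As for every [algType], [1 != 0]. *)
HB.mixin Record isCStarAlgebra (R : realType) A of GRing.Algebra R[i] A := {
  star : A -> A;
  starK : involutive star;
  starM : forall x y : A, star (x * y) = star y * star x;
  starD : forall x y : A, star (x + y) = star x + star y;
  starZ : forall (c : R[i]) (x : A), star (c *: x) = c^*%C *: star x;
  cnorm : A -> R;
  cnorm_ge0 : forall x : A, 0 <= cnorm x;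
  cnorm_eq0 : forall x : A, cnorm x = 0 -> x = 0;
  cnormD : forall x y : A, cnorm (x + y) <= cnorm x + cnorm y;
  cnormZ : forall (c : R[i]) (x : A), cnorm (c *: x) = Normc.normc c * cnorm x;
  cnormM : forall x y : A, cnorm (x * y) <= cnorm x * cnorm y;
  cnorm_star : forall x : A, cnorm (star x * x) = cnorm x ^+ 2;
  cnorm_complete : forall u : nat -> A,
    (forall eps : R, 0 < eps ->
      exists N : nat, forall m n : nat, (N <= m)%N -> (N <= n)%N ->
        cnorm (u m - u n) < eps) ->
    exists l : A, cnorm (u n - l) @[n --> \oo] --> (0 : R) }.

#[short(type="cstarAlgType")]
HB.structure Definition CStarAlgebra (R : realType) :=
  { A of GRing.Algebra R[i] A & isCStarAlgebra R A }.

Section UniversalAlgebras.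
Variables (R : realType) (E : Type).

(* The smallest norm-closed unital *-subalgebra containing the [S e] is [A]. *)
Definition generates (A : cstarAlgType R) (S : E -> A) :=
  forall D : set A,
    (forall e, D (S e)) ->
    D 1 ->
    (forall x y, D x -> D y -> D (x + y)) ->
    (forall (c : R[i]) x, D x -> D (c *: x)) ->
    (forall x y, D x -> D y -> D (x * y)) ->
    (forall x, D x -> D (star x)) ->
    (forall (u : nat -> A) (l : A), (forall n, D (u n)) ->
       cnorm (u n - l) @[n --> \oo] --> (0 : R) -> D l) ->
    forall x, D x.

(* [(A, S)] is the universal unital C*-algebra generated by a family of
   elements satisfying the relations [rel]. *)
Definition universal_cstar (rel : forall B : cstarAlgType R, (E -> B) -> Prop)
    (A : cstarAlgType R) (S : E -> A) :=
  [/\ rel A S, generates S &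
      forall (B : cstarAlgType R) (T : E -> B), rel B T ->
        exists phi : {lrmorphism A -> B},
          (forall x, phi (star x) = star (phi x)) /\
          (forall e, phi (S e) = T e)].

End UniversalAlgebras.

Definition partial_isometry (R : realType) (A : cstarAlgType R) (u : A) :=
  u * star u * u = u.

Section CuntzKrieger.
Variables (R : realType) (E : finType).

Definition cuntz_krieger_family (M : E -> E -> nat)
    (A : cstarAlgType R) (S : E -> A) :=
  [/\ forall e, partial_isometry (S e),
      \sum_f S f * star (S f) = 1 &
      forall e, star (S e) * S e = \sum_f (S f * star (S f)) *+ M e f].

Definition cuntz_family (A : cstarAlgType R) (S : E -> A) :=
  (forall e, star (S e) * S e = 1) /\ \sum_e S e * star (S e) = 1.

Definition is_cuntz_krieger_algebra (M : E -> E -> nat)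
    (A : cstarAlgType R) (S : E -> A) :=
  universal_cstar (cuntz_krieger_family M) S.

Definition is_cuntz_algebra (A : cstarAlgType R) (S : E -> A) :=
  universal_cstar cuntz_family S.

(* The letter [inl e] stands for S_e and [inr e] for its adjoint. *)
Definition letter_eval (A : cstarAlgType R) (S : E -> A) (x : E + E) : A :=
  match x with inl e => S e | inr e => star (S e) end.

Definition word_eval (A : cstarAlgType R) (S : E -> A) (X : seq (E + E)) : A :=
  \prod_(x <- X) letter_eval S x.

End CuntzKrieger.

Section GCatalan.
Variables (R : realType) (G : digraph).
Variables (O : cstarAlgType R) (S : edge G -> O).
Variables (O' : cstarAlgType R) (S' : edge G -> O').

Definition vertex_proj (v : vertex G) : O :=
  \sum_(f | src f == v) S f * star (S f).

Definition gcatalan_words (n : nat) : {set (2 * n)%N.-tuple (edge G + edge G)} :=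
  [set X : (2 * n)%N.-tuple (edge G + edge G) |
    `[< word_eval S X <> 0 /\ word_eval S' X = 1 >]]%SET.

(* [word_eval S X = vertex_proj v] says that [v] is the vertex v(X). *)
Definition gcatalan (n : nat) (v : vertex G) : nat :=
  if n is 0 then 1
  else #|[set X in gcatalan_words n | `[< word_eval S X = vertex_proj v >]]%SET|.

Definition gcatalan_series (v : vertex G) (z : R[i]) : R[i] :=
  limn (series (fun n => (gcatalan n v)%:R * z ^+ n) : nat -> R[i]^o).

End GCatalan.

Definition catalan_map (R : realType) (G : digraph) (i : vertex G)
    (w : vertex G -> R[i]) : R[i] :=
  (w i + 1) * \sum_(j : vertex G) (vertex_matrix j i)%:R * (w j + 1).

Section Curves.
Variable R : realType.
Implicit Types (gam : R -> R[i]) (g h : R[i] -> R[i]).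

Definition deriveC (g : R[i] -> R[i]) (z : R[i]) : R[i] :=
  @derive1 R[i] R[i]^o g z.

Definition derive_path gam (t : R) : R[i] :=
  Complex (derive1 (fun s => complex.Re (gam s)) t)
          (derive1 (fun s => complex.Im (gam s)) t).

Definition integral01 (k : R -> R[i]) : R[i] :=
  Complex
    (\int[@lebesgue_measure R]_(t in `[0%R, 1%R]) complex.Re (k t))%R
    (\int[@lebesgue_measure R]_(t in `[0%R, 1%R]) complex.Im (k t))%R.

(* The integral of [g dh] along [gam], i.e. of
   g (gam t) * (h o gam)' (t) over 0 <= t <= 1. *)
Definition curve_integral gam g h : R[i] :=
  integral01 (fun t => g (gam t) * derive_path (h \o gam) t).

(* On [a, b] the derivative extends continuously to the endpoints. *)
Definition C1_on (f : R -> R) (a b : R) :=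
  exists d : R -> R, {within `[a, b], continuous d} /\
    forall t, t \in `]a, b[ -> is_derive t 1 f (d t).

Definition piecewise_C1 gam :=
  [/\ {within `[0%R, 1%R], continuous (fun t => complex.Re (gam t))},
      {within `[0%R, 1%R], continuous (fun t => complex.Im (gam t))} &
      exists s : seq R, [/\ path <%R 0 s, last 0 s = 1 &
        forall k, (k < size s)%N ->
          C1_on (fun t => complex.Re (gam t)) (nth 0 (0 :: s) k) (nth 0 s k) /\
          C1_on (fun t => complex.Im (gam t)) (nth 0 (0 :: s) k) (nth 0 s k)]].

Definition simple_closed gam :=
  gam 0 = gam 1 /\ {in `[0, 1[ &, injective gam}.

(* The winding number of [gam] about the origin is 1; for a simple closed
   curve: it encloses the origin and is positively oriented. *)
Definition positively_around0 gam :=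
  (forall t, t \in `[0, 1] -> gam t != 0) /\
  curve_integral gam (fun z => z^-1) id = Complex 0 (2 * pi).

Definition within_radius (r : R) gam :=
  forall t, t \in `[0, 1] -> Normc.normc (gam t) < r.

Definition small_loop_around0 (r : R) gam :=
  [/\ piecewise_C1 gam, simple_closed gam, positively_around0 gam &
      within_radius r gam].

End Curves.

(* Main.v *)
Require Import Defs.
From mathcomp Require Import all_boot all_order all_algebra.
From mathcomp Require Import all_classical all_reals all_analysis.
From mathcomp Require Import complex.
From mathcomp Require Import measurable_realfun ring lra zify.
Import numFieldNormedType.Exports.
Import Order.TTheory GRing.Theory Num.Theory.

Set Implicit Arguments.
Unset Strict Implicit.
Unset Printing Implicit Defensive.

Local Open Scope classical_set_scope.
Local Open Scope ring_scope.

(** In the Cuntz algebra a word evaluates to 1 exactly when it is a Dyck word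
    whose brackets [S_e^* ... S_e] match.  Among these, the nonzero words of the
    Cuntz-Krieger algebra are those whose brackets are compatible with the
    graph, and the first-return decomposition [S_e^* Y S_e Z] of such a word
    gives [w_i = z F_i(w)].  Hence [F_j^n / w_j^n = z^-n] near the origin, and
    [w_i' z^-n] differs from [n c_n / z] by the derivative of a function on the
    punctured disc.  Only the defining relations of the two algebras are used:
    that projections with sum 1 are orthogonal is an extreme point argument, and
    the vertex projections are nonzero by irreducibility. *)

(** * Orthogonality of projections with sum 1 *)

(** Orthogonality would usually follow from positivity: compressions [p q_k p] with sum zero vanish.
    Here it is derived from norms and the C*-identity alone. The crux is that [p] is extreme among
    the self-adjoint elements of the unit ball of its corner: if [p + h] and [p - h] lie in the
    ball, so do [p + (3/2) h] and [p - (3/2) h], and iteration forces [h = 0]. In place of Cauchy's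
    theorem, every power of z other than 1/z gets an explicit primitive, and the integral of dz/z is
    known from the hypothesis on the curve. The constants come from [K = (2|E|)^2], the number of
    two-letter words. On [K |z| <= 1/4] the terms decay like 4^-n, so Cauchy products with their n +
    1 summands still decay like 2^-n. Differentiation doubles [K], whence the radius 1/(8K). On this
    disc each [f_i] also stays within 1/2 of 1, which keeps [w_j] nonzero off the origin. *)

Section CStar.
Variables (R : realType) (A : cstarAlgType R).
Implicit Types (x y p q h : A) (c t : R[i]).

Lemma star0 : star (0 : A) = 0.
Proof. by rewrite -[0 in LHS](scale0r (0 : A)) starZ rmorph0 scale0r. Qed.

Lemma starN x : star (- x) = - star x.
Proof. by apply/eqP; rewrite -addr_eq0 -starD addNr star0. Qed.

Lemma starB x y : star (x - y) = star x - star y.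
Proof. by rewrite starD starN. Qed.

Lemma star1 : star (1 : A) = 1.
Proof. by rewrite -[LHS]mul1r -[X in X * _]starK -starM mul1r starK. Qed.

Lemma star_sum (I : Type) (r : seq I) (P : pred I) (F : I -> A) :
  star (\sum_(i <- r | P i) F i) = \sum_(i <- r | P i) star (F i).
Proof. by apply: (big_morph _ starD star0). Qed.

Lemma cnorm0 : cnorm (0 : A) = 0.
Proof. by rewrite -[0 in LHS](scale0r (0 : A)) cnormZ ComplexField.Normc.normc0 mul0r. Qed.

Lemma star_mul_eq0 x : star x * x = 0 -> x = 0.
Proof.
move=> xx0; apply: cnorm_eq0; apply/eqP; have := cnorm_star x.
by rewrite xx0 cnorm0 => /esym/eqP; rewrite expf_eq0.
Qed.

Definition projection p := p * p = p /\ star p = p.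

(** The C*-identity reads [cnorm p = cnorm p ^+ 2], so the norm is 0 or 1. *)
Lemma cnorm_projection_le1 p : projection p -> cnorm p <= 1.
Proof.
move=> [pp sp]; have := cnorm_star p; rewrite sp pp expr2 => e.
have [->|p0] := eqVneq (cnorm p) 0; first exact: ler01.
by rewrite -(mulfI p0 (etrans (mulr1 _) e)).
Qed.

Lemma projectionB1 p : projection p -> projection (1 - p).
Proof.
move=> [pp sp]; split; last by rewrite starB star1 sp.
by rewrite mulrBr mulr1 mulrBl mul1r pp subrr subr0.
Qed.

Lemma cnormM_le1 x y : cnorm x <= 1 -> cnorm y <= 1 -> cnorm (x * y) <= 1.
Proof.
by move=> x1 y1; apply: le_trans (cnormM _ _) _; rewrite mulr_ile1 ?cnorm_ge0.
Qed.

Lemma cnormD_le x y (a b : R) :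
  cnorm x <= a -> cnorm y <= b -> cnorm (x + y) <= a + b.
Proof. by move=> xa yb; apply: le_trans (cnormD _ _) _; rewrite lerD. Qed.

Lemma starZR (a : R) x : star (a%:C%C *: x) = a%:C%C *: star x.
Proof. by rewrite starZ conjc_real. Qed.

Lemma cnorm_scaleR (a : R) x : 0 <= a -> cnorm (a%:C%C *: x) = a * cnorm x.
Proof. by move=> a0; rewrite cnormZ /= expr0n addr0 sqrtr_sqr ger0_norm. Qed.

Lemma cnormN x : cnorm (- x) = cnorm x.
Proof. by rewrite -scaleN1r cnormZ normcN ComplexField.Normc.normc1 mul1r. Qed.

Lemma cnorm_scale_le (a : R) x : 0 <= a -> cnorm x <= 1 ->
  cnorm (a%:C%C *: x) <= a.
Proof.
by move=> a0 x1; rewrite cnorm_scaleR // -[leRHS]mulr1 ler_wpM2l.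
Qed.

Section Corner.
Variables (p h : A).
Hypotheses (proj_p : projection p) (sh : star h = h).
Hypotheses (ph : p * h = h) (hp : h * p = h).

(** In the corner of [p], [p] acts as a unit for [h], so this is the binomial formula in one
    variable. *)
Lemma corner_cube t : (p + t *: h) * (p + t *: h) * (p + t *: h) =
  p + (3%:R * t) *: h + (3%:R * t ^+ 2) *: (h * h) + (t ^+ 3) *: (h * h * h).
Proof.
have [pp _] := proj_p.
have -> : (p + t *: h) * (p + t *: h) = p + (2%:R * t) *: h + t ^+ 2 *: (h * h).
  rewrite mulrDl !mulrDr pp -!scalerAl -!scalerAr ph hp scalerA -!addrA.
  by congr (_ + _); rewrite addrA -scalerDl -mulr2n mulr_natl.
have hhp : h * h * p = h * h by rewrite -mulrA hp.
have -> : 3%:R * t = t + 2%:R * t by ring.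
have -> : 3%:R * t ^+ 2 = 2%:R * t * t + t ^+ 2 by ring.
have -> : t ^+ 3 = t ^+ 2 * t by ring.
move: (2%:R * t) (t ^+ 2) => c d.
rewrite 2!mulrDl !mulrDr pp -!scalerAl -!scalerAr ph hhp hp !scalerA.
by rewrite !scalerDl !addrA.
Qed.

Definition corner_ball t := cnorm (p + t *: h) <= 1.

Lemma corner_ball_cube t : corner_ball t ->
  cnorm (p + (3%:R * t) *: h + (3%:R * t ^+ 2) *: (h * h) +
    (t ^+ 3) *: (h * h * h)) <= 1.
Proof. by move=> b; rewrite -corner_cube !cnormM_le1. Qed.

Lemma corner_ball_convex (s t : R[i]) : corner_ball s -> corner_ball t ->
  corner_ball ((s + t) / 2%:R).
Proof.
move=> bs bt; rewrite /corner_ball.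
have half : (0 : R) <= 2%:R^-1 by rewrite invr_ge0.
have e2 : (2%:R^-1)%:C%C = 2%:R^-1 :> R[i] by rewrite fmorphV rmorph_nat.
have -> : p + ((s + t) / 2%:R) *: h =
  (2%:R^-1)%:C%C *: (p + s *: h) + (2%:R^-1)%:C%C *: (p + t *: h).
  rewrite e2 !scalerDr addrACA -scalerDl !scalerA -scalerDl.
  by congr (_ + _ *: _); [rewrite -[LHS]scale1r; congr (_ *: _); field | field].
apply: le_trans (cnormD _ _) _.
apply: le_trans (lerD (cnorm_scale_le half bs) (cnorm_scale_le half bt)) _.
by lra.
Qed.

(* The C*-identity turns [|p + ih|^2] into [|p + h^2|], and [p + h^2] is the
   mean of [(p + h)^2] and [(p - h)^2]. *)
Lemma corner_ball_i : corner_ball 1 -> corner_ball (-1) ->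
  corner_ball 'i%C /\ corner_ball (- 'i%C).
Proof.
have [pp sp] := proj_p.
rewrite /corner_ball !scaleNr !scale1r => b1 bN1.
have half : (0 : R) <= 2%:R^-1 by rewrite invr_ge0.
have e2 : (2%:R^-1)%:C%C = 2%:R^-1 :> R[i] by rewrite fmorphV rmorph_nat.
have bhh : cnorm (p + h * h) <= 1.
  have -> : p + h * h = (2%:R^-1)%:C%C *: ((p + h) * (p + h)) +
     (2%:R^-1)%:C%C *: ((p - h) * (p - h)).
    rewrite e2 -scalerDr !mulrDl !mulrDr !(mulNr, mulrN) opprK pp ph hp.
    rewrite -[X in _ *: X](_ : 2%:R *: (p + h * h) = _); last first.
      rewrite scaler_nat mulr2n [RHS]addrACA [X in _ = X + _]addrACA.
      by rewrite [X in _ = _ + X]addrACA subrr addr0 add0r addrACA.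
    by rewrite scalerA mulVf ?scale1r ?pnatr_eq0.
  apply: le_trans (cnormD _ _) _.
  apply: le_trans (lerD (cnorm_scale_le half (cnormM_le1 b1 b1))
    (cnorm_scale_le half (cnormM_le1 bN1 bN1))) _.
  by lra.
have si : star ('i%C *: h) = - ('i%C *: h).
  rewrite starZ sh -scaleNr; congr (_ *: _); apply/eqP; rewrite eq_complex /=.
  by rewrite oppr0 !eqxx.
have sqi x : star x = - x -> p * x = x -> x * p = x -> x * x = - (h * h) ->
    cnorm (p + x) <= 1.
  move=> sx px xp xx; rewrite -(@ler_pXn2r _ 2) ?nnegrE ?cnorm_ge0 ?ler01 //.
  rewrite expr1n -cnorm_star starD sp sx mulrDl !mulrDr pp px !(mulNr, xp).
  by rewrite xx opprK addrA addrK.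
have ii : 'i%C *: h * ('i%C *: h) = - (h * h).
  by rewrite -scalerAl -scalerAr scalerA -expr2 sqr_i scaleN1r.
split; apply: sqi => //; rewrite ?starN ?si ?mulrN ?mulNr ?opprK //.
- by rewrite -scalerAr ph.
- by rewrite -scalerAl hp.
- by rewrite -scalerAr ph.
- by rewrite -scalerAl hp.
Qed.

(* The weights and nodes are chosen so that the second and third moments
   vanish while the first one is 1/2: the mean of [(p + t h)^3] is
   [p + (3/2) h]. *)
Lemma corner_ball_expand : corner_ball 1 -> corner_ball (-1) ->
  corner_ball (3%:R / 2%:R).
Proof.
move=> b1 bN1; have [bi bNi] := corner_ball_i b1 bN1.
pose V a b c d : A := a *: p + b *: h + c *: (h * h) + d *: (h * h * h).
have VD a b c d a' b' c' d' :
    V a b c d + V a' b' c' d' = V (a + a') (b + b') (c + c') (d + d').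
  by rewrite /V !scalerDl addrACA [X in X + _ = _]addrACA [X in X + _ + _ = _]addrACA.
have VZ s a b c d : s *: V a b c d = V (s * a) (s * b) (s * c) (s * d).
  by rewrite /V !scalerDr !scalerA.
have bV t : corner_ball t ->
    cnorm (V 1 (3%:R * t) (3%:R * t ^+ 2) (t ^+ 3)) <= 1.
  by move=> /corner_ball_cube; rewrite /V scale1r.
have w (n : nat) x : cnorm x <= 1 -> cnorm ((n%:R^-1 : R[i]) *: x) <= n%:R^-1.
  move=> x1; have -> : n%:R^-1 = (n%:R^-1)%:C%C :> R[i] by rewrite fmorphV rmorph_nat.
  by apply: cnorm_scale_le; rewrite ?invr_ge0.
have b3 := w 3 _ (bV _ (corner_ball_convex b1 bi)).
have b4 := w 3 _ (bV _ (corner_ball_convex b1 bNi)).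
have b5 := w 6 _ (bV _ b1).
have b6 := w 12 _ (bV _ bi).
have b7 := w 12 _ (bV _ bNi).
rewrite !VZ in b3 b4 b5 b6 b7.
have := cnormD_le (cnormD_le (cnormD_le b3 b4) (cnormD_le b6 b7)) b5.
rewrite !VD.
have i2 : 'i%C ^+ 2 = -1 :> R[i] := sqr_i R.
(* With [I] as an indeterminate, [field] computes the moments of the five weighted nodes; the second
   and third come out as multiples of [I ^+ 2 + 1]. *)
set I := 'i%C in i2 *.
rewrite [X in V X](_ : _ = 1); last by field.
rewrite [X in V _ X](_ : _ = 3%:R / 2%:R); last by field.
rewrite [X in V _ _ X](_ : _ = I ^+ 2 + 1); last by field.
rewrite [X in V _ _ _ X](_ : _ = (I ^+ 2 + 1) / 4%:R); last by field.
rewrite i2 addNr mul0r /V scale1r !scale0r !addr0 /corner_ball => b.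
by apply: le_trans b _; lra.
Qed.

End Corner.

(** Extremality of [p]: by [corner_ball_expand] for [h] and [-h], the hypotheses pass to [(3/2)^m h]
    for every [m]. Half the difference of the two ball elements then has norm at most 1, so
    [(3/2)^m |h|] stays bounded. *)
Lemma corner_ball_trivial p h : projection p -> star h = h ->
  p * h = h -> h * p = h -> cnorm (p + h) <= 1 -> cnorm (p - h) <= 1 -> h = 0.
Proof.
move=> pp sh ph hp b bN.
pose k : R[i] := 3%:R / 2%:R.
have kE : k = (3%:R / 2%:R)%:C%C by rewrite /k fmorph_div !rmorph_nat.
have bk m : cnorm (p + k ^+ m *: h) <= 1 /\ cnorm (p - k ^+ m *: h) <= 1.
  elim: m => [|m [IH IHN]]; first by rewrite expr0 scale1r.
  have sh' : star (k ^+ m *: h) = k ^+ m *: h.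
    by rewrite kE -rmorphXn starZR sh.
  have ph' : p * (k ^+ m *: h) = k ^+ m *: h by rewrite -scalerAr ph.
  have hp' : (k ^+ m *: h) * p = k ^+ m *: h by rewrite -scalerAl hp.
  have step g : star g = g -> p * g = g -> g * p = g -> cnorm (p + g) <= 1 ->
      cnorm (p - g) <= 1 -> cnorm (p + k *: g) <= 1.
    move=> sg pg gp c1 cN; apply: corner_ball_expand => //; rewrite /corner_ball.
      by rewrite scale1r.
    by rewrite scaleN1r.
  rewrite exprS -scalerA; split; first exact: step.
  by rewrite -scalerN; apply: step; rewrite ?starN ?mulrN ?mulNr ?opprK ?sh' ?ph' ?hp'.
apply: cnorm_eq0; apply/eqP; apply: contraT => h0.
have h0' : 0 < cnorm h by rewrite lt_neqAle eq_sym h0 cnorm_ge0.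
have bound m : (3%:R / 2%:R) ^+ m * cnorm h <= 1.
  have [b1 b2] := bk m; set g := k ^+ m *: h in b1 b2.
  have -> : (3%:R / 2%:R) ^+ m * cnorm h = cnorm g.
    by rewrite /g kE -rmorphXn cnorm_scaleR // exprn_ge0 // divr_ge0 ?ler0n.
  have : cnorm (g + g) <= 1 + 1.
    have -> : g + g = (p + g) + - (p - g) by rewrite opprB addrCA [p + g]addrC addrK.
    by apply: le_trans (cnormD _ _) _; rewrite cnormN lerD.
  have -> : cnorm (g + g) = 2%:R * cnorm g.
    by rewrite -mulr2n -scaler_nat -(rmorph_nat (real_complex R)) cnorm_scaleR.
  by lra.
have bern m : 1 + m%:R / 2%:R <= (3%:R / 2%:R) ^+ m :> R.
  elim: m => [|m IH]; first by rewrite mul0r addr0 expr0.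
  rewrite exprS -natr1; have : (0 : R) <= m%:R by [].
  by nra.
have [m] : exists m : nat, 2%:R / cnorm h < m%:R.
  by exists (Num.bound (2%:R / cnorm h)); rewrite archi_boundP // divr_ge0 // cnorm_ge0.
rewrite ltr_pdivrMr // => mh; have := bound m; have := bern m.
have := ler_wpM2r (ltW h0') (bern m).
by nra.
Qed.

(* For [p = q i] the compressions [p q_k p], [k != i], sum to zero and each
   [p - p q_k p] lies in the unit ball; so do [p + h] and [p - h] for [h] a small
   multiple of one compression, whence [h = 0]. *)
Lemma orthogonal_of_sum1 (I : finType) (q : I -> A) :
  (forall i, projection (q i)) -> \sum_i q i = 1 ->
  forall i j, i != j -> q i * q j = 0.
Proof.
move=> pq sq i j ij.
pose p := q i; have [pp sp] := pq i.
pose y k := p * q k * p.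
have y0 : \sum_(k | k != i) y k = 0.
  have : p * (\sum_k q k) * p = p by rewrite sq mulr1 pp.
  rewrite mulr_sumr mulr_suml (bigD1 i) //= -/p !pp.
  by move/(canRL (addKr _)); rewrite addNr.
have yball k : cnorm (p - y k) <= 1.
  have -> : p - y k = p * (1 - q k) * p by rewrite mulrBr mulr1 mulrBl pp.
  by rewrite !cnormM_le1 ?cnorm_projection_le1 //; exact: projectionB1.
have yj : y j = 0.
  (* Since the compressions sum to zero, [p *+ m + y j] is the sum of the [m] ball elements
     [p - y k] with [k] other than [i] and [j]; its norm is at most [m]. *)
  pose m := #|[pred k | (k != i) && (k != j)]|.
  have sumy : \sum_(k | (k != i) && (k != j)) (p - y k) = p *+ m + y j.
    rewrite sumrB sumr_const -/m; congr (_ + _); apply/eqP.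
    move: y0; rewrite (bigD1 j) 1?eq_sym //= => /eqP.
    by rewrite addrC addr_eq0 => /eqP ->; rewrite opprK.
  have bm : cnorm (p *+ m + y j) <= m%:R.
    rewrite -sumy /m -sum1_card natr_sum.
    elim/big_ind2: _ => [|x a x' a' xa xa'|k _]; first by rewrite cnorm0.
      by apply: le_trans (cnormD _ _) _; rewrite lerD.
    exact: yball.
  (* With [M = m + 1], both [M p + y j = (m p + y j) + p] and [M p - y j = m p + (p - y j)] have
     norm at most [M]; dividing by [M] puts [p + h] and [p - h] in the ball. *)
  pose M : R := m.+1%:R; have M0 : 0 < M by rewrite ltr0Sn.
  pose h := (M^-1)%:C%C *: y j.
  have MhE : M%:C%C *: h = y j.
    by rewrite scalerA -rmorphM /= divff ?gt_eqF // rmorph1 scale1r.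
  have MpE : M%:C%C *: p = p *+ m + p by rewrite rmorph_nat scaler_nat mulrSr.
  have yp : y j * p = y j by rewrite /y -mulrA pp.
  have py : p * y j = y j by rewrite /y !mulrA pp.
  have sy : star (y j) = y j.
    by have [_ sqj] := pq j; rewrite /y !starM sp sqj mulrA.
  have p1 : cnorm p <= 1 by exact: cnorm_projection_le1.
  suff h0 : h = 0 by rewrite -MhE h0 scaler0.
  apply: (@corner_ball_trivial p) => //.
  - by rewrite starZR sy.
  - by rewrite -scalerAr py.
  - by rewrite -scalerAl yp.
  - rewrite -(ler_pM2l M0) -(cnorm_scaleR _ (ltW M0)) scalerDr MhE MpE mulr1 addrAC.
    by rewrite /M -natr1 cnormD_le.
  - rewrite -(ler_pM2l M0) -(cnorm_scaleR _ (ltW M0)) scalerBr MhE MpE mulr1 -addrA.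
    apply: le_trans (cnormD _ _) _; rewrite /M -natr1 lerD //.
    rewrite -scaler_nat -(rmorph_nat (real_complex R)) cnorm_scaleR //.
    by rewrite ler_piMr.
(* This product is [p q_j p], the compression just shown to vanish. *)
have : star (q j * p) * (q j * p) = 0.
  have [qq sqj] := pq j.
  by rewrite starM sp sqj mulrA -[X in X * _]mulrA qq.
move/star_mul_eq0 => /(congr1 star); rewrite starM star0 sp.
by have [_ ->] := pq j.
Qed.

End CStar.

Section Ranges.
Variables (R : realType) (A : cstarAlgType R) (E : finType) (S : E -> A).
Hypotheses (S_pi : forall e, partial_isometry (S e)).
Hypothesis (S_sum : \sum_f S f * star (S f) = 1).

Lemma range_projection e : projection (S e * star (S e)).
Proof. by split; [rewrite mulrA S_pi | rewrite starM starK]. Qed.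

Lemma star_range e : star (S e) * S e * star (S e) = star (S e).
Proof. by rewrite -[RHS](congr1 star (S_pi e)) !starM starK mulrA. Qed.

(** Insert the range projections: the product factors through [S_e S_e^* S_f S_f^*]. *)
Lemma partial_isometry_orth e f : e != f -> star (S e) * S f = 0.
Proof.
move=> ef; have := orthogonal_of_sum1 range_projection S_sum ef.
move=> o.
have -> : star (S e) * S f =
    star (S e) * (S e * star (S e) * (S f * star (S f))) * S f.
  by rewrite !mulrA star_range -[RHS]mulrA -[RHS]mulrA [S f * _]mulrA S_pi.
by rewrite o mulr0 mul0r.
Qed.

End Ranges.

(** * Cuntz-Krieger families of a graph *)

Section CuntzKriegerGraph.
Variables (R : realType) (G : digraph) (O : cstarAlgType R) (S : edge G -> O).
Hypothesis S_CK : cuntz_krieger_family (@edge_matrix G) S.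
Let P := vertex_proj S.

Let S_pi e : partial_isometry (S e). Proof. by case: S_CK. Qed.
Let S_sum : \sum_f S f * star (S f) = 1. Proof. by case: S_CK. Qed.
Let orth e f : e != f -> star (S e) * S f = 0.
Proof. exact: partial_isometry_orth. Qed.

Lemma star_edge_mul e : star (S e) * S e = P (tgt e).
Proof.
case: S_CK => _ _ ->; rewrite /P /vertex_proj [RHS]big_mkcond /=.
by apply: eq_bigr => f _; rewrite /edge_matrix eq_sym; case: eqP.
Qed.

Lemma vertex_proj_mul_edge v e : P v * S e = if src e == v then S e else 0.
Proof.
rewrite /P /vertex_proj mulr_suml; case: ifP => ev; last first.
  rewrite big1 // => f fv; rewrite -mulrA orth ?mulr0 //.
  by apply: contraFN ev => /eqP <-.
rewrite (bigD1 e) //= S_pi big1 ?addr0 // => f /andP[_ fe].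
by rewrite -mulrA orth ?mulr0.
Qed.

Lemma star_vertex_proj v : star (P v) = P v.
Proof.
by rewrite star_sum; apply: eq_bigr => e _; rewrite starM starK.
Qed.

Lemma star_edge_mul_vertex_proj v e :
  star (S e) * P v = if src e == v then star (S e) else 0.
Proof.
rewrite -[LHS]starK starM starK star_vertex_proj vertex_proj_mul_edge.
by case: ifP; rewrite ?star0.
Qed.

Lemma vertex_proj_mul u v : P u * P v = if u == v then P v else 0.
Proof.
rewrite [X in _ * X]/P /vertex_proj mulr_sumr.
under eq_bigr => e /eqP ev do rewrite mulrA vertex_proj_mul_edge ev eq_sym.
case: ifP => // _; rewrite big1 // => e _; exact: mul0r.
Qed.

(** The initial projection of [S e] sits at the target of [e]. Hence [star (S e)], read from the
    left, leads from [tgt e] to [src e], and a word at [v] opens with an edge into [v]. *)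
Lemma vertex_proj_mul_star_edge v e :
  P v * star (S e) = if tgt e == v then star (S e) else 0.
Proof.
rewrite -[star (S e) in LHS](star_range S_pi) star_edge_mul mulrA vertex_proj_mul.
rewrite eq_sym; case: ifP => [/eqP ev|_]; last by rewrite mul0r.
by rewrite -star_edge_mul star_range.
Qed.

Lemma sum_vertex_proj : \sum_v P v = 1.
Proof. by rewrite -S_sum (partition_big (@src G) predT). Qed.

(* [P u = 0] forces [S e = 0] for the edges [e] out of [u], hence
   [P (tgt e) = 0]; so zeros would spread over the whole graph. *)
Lemma vertex_proj_neq0 : irreducible G -> forall v, P v <> 0.
Proof.
move=> irr v Pv0.
have step u w : Defs.adjacent u w -> P u = 0 -> P w = 0.
  move=> /existsP[e /andP[/eqP eu /eqP ew]] Pu0.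
  have := vertex_proj_mul_edge u e; rewrite eu eqxx Pu0 mul0r => Se0.
  by rewrite -ew -star_edge_mul -Se0 mulr0.
have all0 w : P w = 0.
  have /connectP[p pp ->] := irr v w.
  elim: p v Pv0 pp => //= u p IH v Pv0 /andP[vu pp].
  by apply: IH pp; apply: step Pv0.
have := sum_vertex_proj; rewrite big1 // => /esym/eqP.
by rewrite oner_eq0.
Qed.

End CuntzKriegerGraph.

(** * Dyck words and the Catalan recursion *)

Section Words.
Variable E : finType.
Implicit Types (st : seq E) (X Y Z : seq (E + E)).

(* Reads a word from the left; the stack holds the adjoints [inr e] which have
   not yet met their partner [inl e]. *)
Fixpoint run st X : option (seq E) :=
  match X with
  | [::] => Some st
  | inr e :: X' => run (e :: st) X'
  | inl e :: X' => if st is f :: st' then if e == f then run st' X' else None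
                   else None
  end.

Lemma run_cat st X Y : run st (X ++ Y) = obind (run^~ Y) (run st X).
Proof.
elim: X st => //= -[e|e] X IH [|f st] //=.
by case: ifP => // _; rewrite IH.
Qed.

Lemma run_weaken st st' X t : run st X = Some st' -> run (st ++ t) X = Some (st' ++ t).
Proof.
elim: X st => [|[e|e] X IH] st /=; first by case=> ->.
  by case: st => //= f st; case: ifP => // _; exact: IH.
by move/IH.
Qed.

Lemma run_balanced X t : run [::] X = Some [::] -> run t X = Some t.
Proof. by move/(run_weaken t). Qed.

(** [Y] is read until the stack first falls below [e]. The induction is on length: after the inner
    bracket is split off, the hypothesis is used again on the remainder, which is not a structural
    subterm. *)
Lemma run_split e st X : run (e :: st) X = Some [::] ->
  exists Y Z, [/\ X = Y ++ inl e :: Z, run [::] Y = Some [::] & run st Z = Some [::]].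
Proof.
have [n] := ubnP (size X); elim: n e st X => // n IH e st [//|[f|f] X] /=.
  move=> _; case: ifP => // /eqP -> rX; by exists [::], X.
rewrite ltnS => Xn /IH [//|Y [Z [XE rY rZ]]].
have [|Y' [Z' [ZE rY' rZ']]] := IH _ _ _ _ rZ.
  by apply: leq_trans Xn; rewrite ltnS XE size_cat /= -addSnnS leq_addl.
exists (inr f :: Y ++ inl f :: Y'), Z'; split => //.
  by rewrite XE ZE /= -catA.
by rewrite /= run_cat (run_balanced _ rY) /= eqxx.
Qed.

(** The first return is unique: if [Y] were a proper prefix of [Y'], the letter [inl e] after it
    would be read on an empty stack and [run] on [Y'] would fail. *)
Lemma balanced_prefix_inj e e' Y Y' Z Z' :
  run [::] Y = Some [::] -> run [::] Y' = Some [::] ->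
  Y ++ inl e :: Z = Y' ++ inl e' :: Z' -> Y = Y'.
Proof.
wlog le : e e' Y Y' Z Z' / (size Y <= size Y')%N.
  move=> H; case/orP: (leq_total (size Y) (size Y')) => le rY rY' YY'.
    exact: H YY'.
  by apply/esym; apply: H (esym YY').
move=> rY rY' YY'.
have YE : Y = take (size Y) Y'.
  by have := congr1 (take (size Y)) YY'; rewrite take_size_cat // takel_cat.
have := rY'; rewrite -(cat_take_drop (size Y) Y') -YE run_cat rY /=.
have := congr1 (drop (size Y)) YY'; rewrite drop_size_cat // drop_cat.
case: ltnP => [lt|ge].
  by case: drop => [|x s [<-] _] //; rewrite ?cats0.
by move=> _ _; rewrite drop_oversize // cats0.
Qed.

End Words.

Section CuntzWords.
Variables (R : realType) (E : finType) (A : cstarAlgType R) (S : E -> A).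
Hypotheses (S_cuntz : cuntz_family S) (E2 : (2 <= #|E|)%N).

Let S_iso e : star (S e) * S e = 1. Proof. by case: S_cuntz. Qed.
Let orth e f : e != f -> star (S e) * S f = 0.
Proof.
apply: partial_isometry_orth; last by case: S_cuntz.
by move=> g; rewrite /partial_isometry -mulrA S_iso mulr1.
Qed.

(** For a second generator [f], [star (S f)] annihilates [S e * x] but is itself nonzero. With a
    single generator [S e] would be unitary. *)
Lemma cuntz_edge_not_unit e x : S e * x <> 1.
Proof.
move=> ex.
have [f fe] : exists f, f != e.
  case: (pickP (predC1 e)) => [f|H]; first by exists f.
  by have := cardC1 e; rewrite (eq_card0 H); move: E2; case: #|E| => [|[|n]].
have : star (S f) * (S e * x) = 0 by rewrite mulrA orth ?mul0r.
rewrite ex mulr1 => sf0; have := S_iso f; rewrite sf0 mul0r => /esym/eqP.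
by rewrite oner_eq0.
Qed.

(** The top of the stack is the letter read last, hence the rightmost factor; this explains
    [rev]. *)
Let star_prod (st : seq E) : A := \prod_(e <- rev st) star (S e).

Let star_prod_cons e st : star_prod (e :: st) = star_prod st * star (S e).
Proof. by rewrite /star_prod rev_cons -cats1 big_cat big_seq1. Qed.

Lemma word_eval_cons (S' : E -> A) x X :
  word_eval S' (x :: X) = letter_eval S' x * word_eval S' X.
Proof. exact: big_cons. Qed.

Lemma word_eval_cat (S' : E -> A) X Y :
  word_eval S' (X ++ Y) = word_eval S' X * word_eval S' Y.
Proof. exact: big_cat. Qed.

(** Each failure of [run] is impossible for a value 1: a letter [inl e] without partner gives
    [S e * x = 1], a leftover adjoint gives the same after taking adjoints, and a mismatched pair
    gives 0. *)
Lemma cuntz_word_run X : word_eval S X = 1 -> run [::] X = Some [::].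
Proof.
suff gen st : star_prod st * word_eval S X = 1 -> run st X = Some [::].
  by move=> X1; apply: gen; rewrite X1 mulr1 /star_prod big_nil.
elim: X st => [|[e|e] X IH] st /=.
- rewrite /word_eval big_nil mulr1; case: st => // e st.
  rewrite star_prod_cons => /(congr1 star); rewrite starM starK star1.
  by move/cuntz_edge_not_unit.
- rewrite word_eval_cons /=; case: st => [|f st].
    by rewrite /star_prod big_nil mul1r => /cuntz_edge_not_unit.
  rewrite star_prod_cons -mulrA [star (S f) * _]mulrA eq_sym.
  case: eqP => [->|/eqP fe]; first by rewrite S_iso mul1r => /IH.
  by rewrite orth // mul0r mulr0 => /esym/eqP; rewrite oner_eq0.
- by rewrite word_eval_cons mulrA -star_prod_cons => /IH.
Qed.

Lemma run_cuntz_word X : run [::] X = Some [::] -> word_eval S X = 1.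
Proof.
have [n] := ubnP (size X); elim: n X => // n IH [|[e|e] X] //=.
  by rewrite /word_eval big_nil.
rewrite ltnS => Xn /run_split[Y [Z [XE rY rZ]]].
move: Xn; rewrite XE size_cat /= => Xn.
rewrite word_eval_cons word_eval_cat word_eval_cons /= !IH ?mulr1 ?mul1r //.
  by apply: leq_trans Xn; rewrite ltnS -addSnnS ltnW // ltnS leq_addl.
by apply: leq_trans Xn; rewrite ltnS leq_addr.
Qed.

End CuntzWords.

(** * Words whose brackets are compatible with the graph, and their number *)

Section Rooted.
Variable G : digraph.
Notation word := (seq (edge G + edge G)).
Implicit Types (v : vertex G) (X Y Z : word).

(** A grammar for the words counted at [v]: an edge into [v] encloses a word at its source and is
    followed by a word at [v]. The empty word is rooted everywhere, matching [c_0 = 1]. *)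
Inductive rooted : vertex G -> word -> Prop :=
| rooted_nil v : rooted v [::]
| rooted_cons v e Y Z : tgt e = v -> rooted (src e) Y -> rooted v Z ->
    rooted v (inr e :: Y ++ inl e :: Z).

Lemma rooted_run v X : rooted v X -> run [::] X = Some [::].
Proof.
elim=> {v X} //= v e Y Z _ _ rY _ rZ.
by rewrite run_cat (run_balanced _ rY) /= eqxx.
Qed.

Lemma rooted_inv v X : rooted v X -> X <> [::] -> exists e Y Z,
  [/\ X = inr e :: Y ++ inl e :: Z, tgt e = v, rooted (src e) Y & rooted v Z].
Proof. by case=> // {v X} v e Y Z; exists e, Y, Z. Qed.

Lemma rooted_even v X : rooted v X -> exists k, size X = (2 * k)%N.
Proof.
elim=> {v X} [|v e Y Z _ _ [k kE] _ [l lE]]; first by exists 0.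
by exists (k + l).+1; rewrite /= size_cat /= kE lE; lia.
Qed.

(** The members are plain sequences, since the recursion concatenates words of different lengths. *)
Definition rooted_words n v : seq word :=
  [seq val t | t <- enum [set t : (2 * n)%N.-tuple (edge G + edge G) |
                           `[< rooted v t >]]%SET].

Lemma rooted_wordsP n v X :
  reflect (size X = (2 * n)%N /\ rooted v X) (X \in rooted_words n v).
Proof.
apply: (iffP mapP) => [[Y]|[sX rX]].
  by rewrite mem_enum inE => /asboolP rY ->; rewrite size_tuple.
exists (Tuple (introT eqP sX)) => //.
by rewrite mem_enum inE; apply/asboolP.
Qed.

Lemma rooted_words_uniq n v : uniq (rooted_words n v).
Proof. by rewrite map_inj_uniq ?enum_uniq //; exact: val_inj. Qed.

Lemma rooted_words0 v : rooted_words 0 v = [:: [::]].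
Proof.
suff : perm_eq (rooted_words 0 v) [:: [::]] by apply: perm_small_eq.
apply: uniq_perm; [exact: rooted_words_uniq | by [] |].
move=> X; rewrite inE; apply/rooted_wordsP/eqP => [[/eqP]|->].
  by rewrite muln0 size_eq0 => /eqP.
by split => //; exact: rooted_nil.
Qed.

(** All words of length [2n] in [2|E|] letters are counted; this crude bound supplies the growth
    constant of the series. *)
Lemma size_rooted_words_le n v :
  (size (rooted_words n v) <= ((2 * #|edge G|) ^ 2) ^ n)%N.
Proof.
rewrite size_map -cardE -expnM; apply: leq_trans (max_card _) _.
by rewrite card_tuple card_sum addnn !mul2n.
Qed.

(* First-return decomposition of a nonempty word. *)
Lemma size_rooted_wordsS n v : size (rooted_words n.+1 v) =
  (\sum_(k < n.+1) \sum_(e | tgt e == v)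
     size (rooted_words k (src e)) * size (rooted_words (n - k) v))%N.
Proof.
pose s := [seq (k, e) | k <- iota 0 n.+1, e <- enum [pred e | tgt e == v]].
pose t (x : nat * edge G) := [seq (Y, Z) | Y <- rooted_words x.1 (src x.2),
  Z <- rooted_words (n - x.1) v].
pose f (x : nat * edge G) (y : word * word) : word :=
  inr x.2 :: y.1 ++ inl x.2 :: y.2.
have sP x : x \in s -> (x.1 <= n)%N /\ tgt x.2 = v.
  by move=> /allpairsP[[k e] [+ + ->]]; rewrite mem_iota mem_enum inE add0n ltnS => kn /eqP.
have tP x y : y \in t x ->
    [/\ size y.1 = (2 * x.1)%N, rooted (src x.2) y.1,
        size y.2 = (2 * (n - x.1))%N & rooted v y.2].
  by move=> /allpairsP[[Y Z] /= [/rooted_wordsP[? ?] /rooted_wordsP[? ?] ->]].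
have : perm_eq (rooted_words n.+1 v) [seq f x y | x <- s, y <- t x].
  apply: uniq_perm; first exact: rooted_words_uniq.
    apply: (@allpairs_uniq_dep _ (fun _ => (word * word)%type)).
    - by apply: allpairs_uniq; rewrite ?iota_uniq ?enum_uniq //; apply: in2W => -[? ?] [].
    - move=> x _; apply: allpairs_uniq; rewrite ?rooted_words_uniq //.
      by apply: in2W => -[? ?] [].
    - move=> _ _ /allpairsPdep[x [y [xs yt ->]]] /allpairsPdep[x' [y' [xs' yt' ->]]] /=.
      have [sy ry _ _] := tP _ _ yt; have [sy' ry' _ _] := tP _ _ yt'.
      case: x y x' y' {xs yt xs' yt'} sy ry sy' ry' => k e [Y Z] [k' e'] [Y' Z'] /=.
      rewrite /f /= => sY rY sY' rY' [ee YZ].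
      (* The first return determines [Y], then the length of [Y] determines [k]. *)
      have YY := balanced_prefix_inj (rooted_run rY) (rooted_run rY') YZ.
      move: YZ; rewrite -YY => /(congr1 (drop (size Y))).
      rewrite !drop_size_cat // => -[_ ->].
      move: sY'; rewrite -YY sY => /eqP; rewrite eqn_mul2l /= => /eqP ->.
      by rewrite ee.
  move=> X; apply/rooted_wordsP/allpairsPdep => [[sX rX]|].
    have [|e [Y [Z [XE ev rY rZ]]]] := rooted_inv rX; first by case: (X) sX; rewrite ?mulnS.
    have [[k sY] [l sZ]] := (rooted_even rY, rooted_even rZ).
    have nE : n = (k + l)%N.
      by move: sX; rewrite XE /= size_cat /= sY sZ; lia.
    exists (k, e), (Y, Z); split; last by rewrite XE.
      apply: allpairs_f; first by rewrite mem_iota nE add0n ltnS leq_addr.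
      by rewrite mem_enum inE ev.
    by apply: allpairs_f; apply/rooted_wordsP; rewrite // nE addKn.
  move=> [x [y [xs yt ->]]]; have [xn xv] := sP _ xs.
  have [sY rY sZ rZ] := tP _ _ yt; split; last exact: rooted_cons.
  by rewrite /f /= size_cat /= sY sZ; move: (x.1) xn => k; clear; lia.
move/perm_size => ->; rewrite size_allpairs_dep sumnE big_map big_allpairs.
rewrite -[iota 0 _]/(index_iota 0 n.+1) big_mkord; apply: eq_bigr => k _.
by rewrite big_enum /=; apply: eq_bigr => e _; rewrite size_allpairs.
Qed.

End Rooted.

Section Counting.
Variables (R : realType) (G : digraph).
Hypotheses (G_irreducible : irreducible G) (G_edges : (2 <= #|edge G|)%N).
Variables (O : cstarAlgType R) (S : edge G -> O).
Hypothesis S_CK : cuntz_krieger_family (@edge_matrix G) S.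
Variables (O' : cstarAlgType R) (S' : edge G -> O').
Hypothesis S'_cuntz : cuntz_family S'.
Let P := vertex_proj S.

(** The factor [P v] on the left makes the claim hold for the empty word, whose value is 1, and so
    lets the induction run. *)
Lemma rooted_eval v X : rooted v X -> P v * word_eval S X = P v.
Proof.
elim=> {v X} [v|v e Y Z ev _ rY _ rZ]; first by rewrite /word_eval big_nil mulr1.
rewrite word_eval_cons word_eval_cat word_eval_cons /= mulrA.
rewrite vertex_proj_mul_star_edge // ev eqxx.
have -> : star (S e) = star (S e) * P (src e).
  by rewrite star_edge_mul_vertex_proj // eqxx.
rewrite mulrA -[X in X * _ = _]mulrA rY star_edge_mul_vertex_proj // eqxx mulrA.
by rewrite star_edge_mul // ev.
Qed.

Lemma rooted_eval_neq0 v X : rooted v X -> X <> [::] -> word_eval S X = P v.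
Proof.
move=> rX; have := rooted_eval rX; case: rX => // {v X} v e Y Z ev _ _ + _.
rewrite word_eval_cons mulrA vertex_proj_mul_star_edge // ev eqxx.
by [].
Qed.

(** Nonvanishing enforces compatibility: [P v] kills an opening edge whose target is not [v], and
    the inner word is preceded by [star (S e)], which carries [P (src e)] on its right. *)
Lemma run_rooted v X : run [::] X = Some [::] -> P v * word_eval S X <> 0 ->
  rooted v X.
Proof.
have [n] := ubnP (size X); elim: n v X => // n IH v [|[e|e] X] //=.
  by move=> *; exact: rooted_nil.
rewrite ltnS => Xn /run_split[Y [Z [XE rY rZ]]].
move: Xn; rewrite XE size_cat /= => Xn.
rewrite word_eval_cons word_eval_cat word_eval_cons /= mulrA.
rewrite vertex_proj_mul_star_edge //; case: eqP => [ev|_]; last by rewrite mul0r.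
have sE : star (S e) = star (S e) * P (src e).
  by rewrite star_edge_mul_vertex_proj // eqxx.
move=> nz.
have rsY : rooted (src e) Y.
  apply: IH => //; first by apply: leq_trans Xn; rewrite ltnS leq_addr.
  by move=> Y0; apply: nz; rewrite sE mulrA -[X in X * _]mulrA Y0 mulr0 mul0r.
apply: rooted_cons => //; apply: IH => //.
  by apply: leq_trans Xn; rewrite ltnS -addSnnS ltnW // ltnS leq_addl.
(* [Y] is already known to be rooted, so it is absorbed by [P (src e)]; what remains in front of [Z]
   is [star (S e) * S e = P v]. *)
move=> Z0; apply: nz; rewrite sE mulrA -[X in X * _]mulrA rooted_eval //.
by rewrite -sE mulrA star_edge_mul // ev.
Qed.

(** Irreducibility enters through [P v <> 0]: it turns the value [P v] of a word into the
    nonvanishing that [run_rooted] needs, and shows that rooted words are nonzero. *)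
Lemma gcatalanE n v : gcatalan S S' n v = size (rooted_words n v).
Proof.
case: n => [|n]; first by rewrite rooted_words0.
rewrite /gcatalan size_map -cardE; apply: eq_card => X; rewrite !inE.
have X0 : val X <> [::] by move/(congr1 size); rewrite size_tuple mulnS.
have P0 := vertex_proj_neq0 S_CK G_irreducible (v := v).
apply/andP/asboolP => [[/asboolP[_ X1] /asboolP XP]|rX].
  apply: run_rooted; first exact: cuntz_word_run X1.
  by rewrite XP vertex_proj_mul // eqxx.
have XP := rooted_eval_neq0 rX X0.
split; apply/asboolP => //; split; first by rewrite XP.
by apply: run_cuntz_word => //; apply: rooted_run rX.
Qed.

Lemma gcatalan_le n v :
  (gcatalan S S' n v <= ((2 * #|edge G|) ^ 2) ^ n)%N.
Proof. by rewrite gcatalanE size_rooted_words_le. Qed.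

Lemma gcatalanS n v : gcatalan S S' n.+1 v =
  (\sum_(k < n.+1) \sum_(e | tgt e == v)
     gcatalan S S' k (src e) * gcatalan S S' (n - k) v)%N.
Proof.
rewrite gcatalanE size_rooted_wordsS; apply: eq_bigr => k _.
by apply: eq_bigr => e _; rewrite !gcatalanE.
Qed.

End Counting.

(** * Complex power series *)

Local Notation normc := Normc.normc.

Section ComplexSeries.
Variable R : realType.
Implicit Types (u v : nat -> R[i]) (z : R[i]) (C : R).

Lemma normc_ge0 z : 0 <= normc z.
Proof. by case: z => a b; exact: sqrtr_ge0. Qed.

Lemma normr_normc z : `|z| = (normc z)%:C%C.
Proof. by case: z. Qed.

Lemma ler_Re_normc z : `|complex.Re z| <= normc z.
Proof. by have := normc_ge_Re z; rewrite normr_normc lecR. Qed.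

Lemma ler_Im_normc z : `|complex.Im z| <= normc z.
Proof.
have := ler_Re_normc (z * 'i%C); rewrite ReiNIm normrN.
by rewrite Normc.normcM [X in _ * X]/= expr0n expr1n add0r sqrtr1 mulr1.
Qed.

Lemma ler_normc_ReIm z : normc z <= `|complex.Re z| + `|complex.Im z|.
Proof.
case: z => a b /=; rewrite -(@ger0_norm _ (`|a| + `|b|)) ?addr_ge0 //.
rewrite -sqrtr_sqr ler_wsqrtr // sqrrD !real_normK ?num_real // addrAC.
by rewrite lerDl mulrn_wge0 ?mulr_ge0.
Qed.

Lemma normcX z n : normc (z ^+ n) = normc z ^+ n.
Proof.
by elim: n => [|n IH]; rewrite ?expr0 ?Normc.normc1 // !exprS Normc.normcM IH.
Qed.

Lemma normcB x y : normc (x - y) = normc (y - x) :> R.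
Proof. by rewrite -normcN opprB. Qed.

Lemma normc_real (a : R) : normc a%:C%C = `|a|.
Proof. by rewrite /= expr0n addr0 sqrtr_sqr. Qed.

Lemma normc_nat n : normc (n%:R : R[i]) = n%:R.
Proof. by rewrite -(rmorph_nat (real_complex R)) normc_real normr_nat. Qed.

Lemma ler_normc_sum (I : Type) (r : seq I) (P : pred I) (F : I -> R[i]) :
  normc (\sum_(i <- r | P i) F i) <= \sum_(i <- r | P i) normc (F i).
Proof.
elim/big_ind2: _ => [|x a y b xa yb|//]; first by rewrite Normc.normc0.
by apply: le_trans (le_normcD _ _) _; rewrite lerD.
Qed.

Lemma le_half_exp n : (2%:R^-1 : R) ^+ n * n.+1%:R <= 1.
Proof.
rewrite exprVn mulrC ler_pdivrMr ?exprn_gt0 // mul1r -natrX ler_nat.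
exact: ltn_expl.
Qed.

Lemma le_quarter_half C n : 0 <= C -> C / 4%:R ^+ n <= C / 2%:R ^+ n.
Proof.
move=> C0; rewrite ler_wpM2l // lef_pV2 ?posrE ?exprn_gt0 //.
by rewrite lerXn2r ?nnegrE // ler_nat.
Qed.

Lemma expr4 n : (4%:R : R) ^+ n = 2%:R ^+ n * 2%:R ^+ n.
Proof. by rewrite -exprMn; congr (_ ^+ _); rewrite -natrM. Qed.

Lemma half_exp_small (e C : R) : 0 < e -> exists n, C / 2%:R ^+ n < e.
Proof.
move=> e0; have [n] : exists n : nat, C / e < n%:R.
  exists (Num.bound `|C / e|); apply: le_lt_trans (ler_norm _) _.
  exact: archi_boundP.
rewrite ltr_pdivrMr // => Cn; exists n.
rewrite ltr_pdivrMr ?exprn_gt0 //; apply: lt_le_trans Cn _.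
by rewrite mulrC ler_pM2l // -natrX ler_nat ltnW // ltn_expl.
Qed.

Lemma le_of_half_exp (x C : R) : (forall n, x <= C / 2%:R ^+ n) -> x <= 0.
Proof.
move=> H; rewrite leNgt; apply/negP => /(@half_exp_small _ C)[n].
by rewrite ltNge H.
Qed.

(** The fixed rate gives explicit remainders [2 C / 2^N], so identities between sums reduce to
    comparing remainders. *)
Definition dominated C u := forall n, normc (u n) <= C / 2%:R ^+ n.

Definition psum u N := \sum_(k < N) u k.

(** The same limit as in [gcatalan_series], so that the latter is a [pser] by conversion. *)
Definition csum u : R[i] := limn (series u : nat -> R[i]^o).

Lemma half_psum_le (a : nat -> R) C : (forall n, a n <= C / 2%:R ^+ n) ->
  forall N, \sum_(k < N) a k <= C * (2%:R - 2%:R / 2%:R ^+ N).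
Proof.
move=> aC; elim=> [|N IH]; first by rewrite big_ord0 expr0 divr1 subrr mulr0.
rewrite big_ord_recr /=; apply: le_trans (lerD IH (aC N)) _.
rewrite -mulrDr exprS invfM mulrA mulfV ?pnatr_eq0 // mul1r.
by rewrite le_eqVlt; apply/orP; left; apply/eqP; congr (_ * _); lra.
Qed.

Lemma dominated_ge0 C u : dominated C u -> 0 <= C.
Proof. by move=> /(_ 0); rewrite expr0 divr1; apply: le_trans; exact: normc_ge0. Qed.

Lemma dominated_shift C u N : dominated C u ->
  dominated (C / 2%:R ^+ N) (fun n => u (N + n)%N).
Proof. by move=> uC n; rewrite -mulrA -invfM -exprD. Qed.

Lemma psum_le C u N : dominated C u -> normc (psum u N) <= 2%:R * C.
Proof.
move=> uC; apply: le_trans (ler_normc_sum _ _ _) _.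
apply: le_trans (half_psum_le uC N) _; rewrite mulrC ler_wpM2r //.
  exact: dominated_ge0 uC.
by rewrite gerBl divr_ge0 // exprn_ge0.
Qed.

Lemma psum_split u N M : psum u (N + M) = psum u N + psum (fun n => u (N + n)%N) M.
Proof. by rewrite /psum big_split_ord. Qed.

Lemma dominated_cvg (x : nat -> R) C : (forall n, `|x n| <= C / 2%:R ^+ n) ->
  cvgn (series x).
Proof.
move=> xC; apply: normed_cvg.
apply: (@series_le_cvg _ _ (geometric C (2%:R^-1))) => [n|n|n|].
- exact: normr_ge0.
- by rewrite /= exprVn; apply: le_trans (xC n).
- by rewrite /= exprVn.
- by apply: is_cvg_geometric_series; rewrite ger0_norm // invf_lt1 // ltr1n.
Qed.

Lemma csumP u l : (forall e : R, 0 < e -> exists N, forall n, (N <= n)%N ->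
  normc (l - psum u n) < e) -> csum u = l.
Proof.
move=> H; apply: (@cvg_lim R[i]^o) => //.
apply/(@cvgrPdist_lt R[i] R[i]^o) => e e0.
(* A positive element of [R[i]] is real, so the topology is governed by real radii. *)
have eE : e = (complex.Re e)%:C%C.
  by move: e0; rewrite ltcE /= => /andP[/eqP ei _]; case: e ei => a b /= ->.
have [|N HN] := H (complex.Re e); first by rewrite -ltcR -eE.
exists N => // n /= Nn.
by rewrite normr_normc eE ltcR /series /= big_mkord; exact: HN.
Qed.

Lemma csum_psum C u : dominated C u ->
  forall N, normc (csum u - psum u N) <= 2%:R * C / 2%:R ^+ N.
Proof.
move=> uC.
have ReC n : `|complex.Re (u n)| <= C / 2%:R ^+ n.
  by apply: le_trans (ler_Re_normc _) (uC n).
have ImC n : `|complex.Im (u n)| <= C / 2%:R ^+ n.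
  by apply: le_trans (ler_Im_normc _) (uC n).
have /cvg_ex[a /cvgrPdist_lt ha] := dominated_cvg ReC.
have /cvg_ex[b /cvgrPdist_lt hb] := dominated_cvg ImC.
pose l : R[i] := Complex a b.
have psumRI n : psum u n =
    Complex (series (fun n => complex.Re (u n)) n) (series (fun n => complex.Im (u n)) n).
  rewrite /series /= !big_mkord /psum; elim: n => [|n IH]; first by rewrite !big_ord0.
  by rewrite !big_ord_recr /= IH; case: (u n).
have lP : forall e : R, 0 < e -> exists N, forall n, (N <= n)%N ->
    normc (l - psum u n) < e.
  move=> e e0; have e2 : 0 < e / 2%:R by rewrite divr_gt0.
  have [N1 _ H1] := ha _ e2; have [N2 _ H2] := hb _ e2.
  exists (maxn N1 N2) => n; rewrite geq_max => /andP[n1 n2].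
  apply: le_lt_trans (ler_normc_ReIm _) _; rewrite psumRI /=.
  by have := ltrD (H1 n n1) (H2 n n2); rewrite /= -splitr.
rewrite (csumP lP) => N.
apply/ler_addgt0Pr => e e0; have [M HM] := lP _ e0.
have := HM (N + M)%N (leq_addl _ _); rewrite psum_split opprD addrA => lt.
rewrite -[l - _](addrNK (psum (fun n => u (N + n)%N) M)).
apply: le_trans (le_normcD _ _) _; rewrite addrC lerD ?(ltW lt) //.
by rewrite -mulrA; apply: psum_le; exact: dominated_shift.
Qed.

Lemma csum_le C u : dominated C u -> normc (csum u) <= 2%:R * C.
Proof. by move=> uC; have := csum_psum uC 0; rewrite /psum big_ord0 subr0 expr0 divr1. Qed.

(** The tool behind all the rules for [csum]: an error of geometric size, with any constant,
    identifies the sum. *)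
Lemma csum_unique C D u l : dominated C u ->
  (forall N, normc (l - psum u N) <= D / 2%:R ^+ N) -> csum u = l.
Proof.
move=> uC lD; apply/eqP; rewrite -subr_eq0; apply/eqP/Normc.eq0_normc/eqP.
rewrite eq_le normc_ge0 andbT; apply: (@le_of_half_exp _ (2%:R * C + D)) => N.
rewrite -(subrKA (psum u N)); apply: le_trans (le_normcD _ _) _.
rewrite mulrDl lerD ?csum_psum //.
by rewrite normcB; exact: lD.
Qed.

Lemma dominatedD C D u v : dominated C u -> dominated D v ->
  dominated (C + D) (fun n => u n + v n).
Proof.
by move=> uC vD n; apply: le_trans (le_normcD _ _) _; rewrite mulrDl lerD.
Qed.

Lemma dominatedZ C c u : dominated C u ->
  dominated (normc c * C) (fun n => c * u n).
Proof.
by move=> uC n; rewrite Normc.normcM -mulrA ler_wpM2l ?normc_ge0.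
Qed.

Lemma csumD C D u v : dominated C u -> dominated D v ->
  csum (fun n => u n + v n) = csum u + csum v.
Proof.
move=> uC vD; apply: csum_unique (dominatedD uC vD) _ => N.
rewrite /psum big_split /= opprD addrACA; apply: le_trans (le_normcD _ _) _.
by apply: le_trans (lerD (csum_psum uC N) (csum_psum vD N)) _; rewrite -mulrDl.
Qed.

Lemma csumZ C c u : dominated C u -> csum (fun n => c * u n) = c * csum u.
Proof.
move=> uC; apply: csum_unique (dominatedZ c uC) _ => N.
rewrite /psum -mulr_sumr -mulrBr Normc.normcM.
apply: le_trans (ler_wpM2l (normc_ge0 c) (csum_psum uC N)) _.
by rewrite !mulrA.
Qed.

Lemma csum_split C u N : dominated C u ->
  csum u = psum u N + csum (fun n => u (N + n)%N).
Proof.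
move=> uC; have sC := dominated_shift N uC.
have -> : csum (fun n => u (N + n)%N) = csum u - psum u N.
  apply: csum_unique sC _ => M; rewrite -addrA -opprD -psum_split.
  by have := csum_psum uC (N + M); rewrite exprD invfM mulrA; exact.
by rewrite addrC subrK.
Qed.

Lemma eq_csum u v : u =1 v -> csum u = csum v.
Proof. by move=> uv; have -> : u = v by apply/funext. Qed.

Lemma csum_sum (I : Type) (r : seq I) (P : pred I) (C : I -> R)
    (u : I -> nat -> R[i]) :
  (forall i, dominated (C i) (u i)) ->
  dominated (\sum_(i <- r | P i) C i) (fun n => \sum_(i <- r | P i) u i n) /\
  csum (fun n => \sum_(i <- r | P i) u i n) = \sum_(i <- r | P i) csum (u i).
Proof.
move=> uC; elim: r => [|i r [IHd IHs]].
  rewrite !big_nil.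
  have d0 : dominated 0 (fun n => \sum_(i <- [::] | P i) u i n).
    by move=> n; rewrite big_nil Normc.normc0 mul0r.
  split=> //; apply: (@csum_unique _ 0 _ _ d0) => N; rewrite /psum big1; last first.
    by move=> k _; rewrite big_nil.
  by rewrite subrr Normc.normc0 mul0r.
rewrite !big_cons.
have -> : (fun n => \sum_(j <- i :: r | P j) u j n) =
    fun n => if P i then u i n + \sum_(j <- r | P j) u j n
             else \sum_(j <- r | P j) u j n.
  by apply/funext => n; rewrite big_cons.
case: (P i) => //; rewrite -IHs; split; first exact: dominatedD.
exact: csumD (uC i) IHd.
Qed.

(* Mertens: the [N]-th partial sum of the product is
   [\sum_(i < N) u i * psum v (N - i)]. *)
Lemma csumM C D u v :
  (forall n, normc (u n) <= C / 4%:R ^+ n) ->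
  (forall n, normc (v n) <= D / 4%:R ^+ n) ->
  csum u * csum v = csum (fun n => \sum_(k < n.+1) u k * v (n - k)%N).
Proof.
move=> uC vD.
have C0 : 0 <= C by have := uC 0; rewrite expr0 divr1; apply: le_trans; exact: normc_ge0.
have D0 : 0 <= D by have := vD 0; rewrite expr0 divr1; apply: le_trans; exact: normc_ge0.
have uC2 : dominated C u by move=> n; apply: le_trans (uC n) (le_quarter_half _ C0).
have vD2 : dominated D v by move=> n; apply: le_trans (vD n) (le_quarter_half _ D0).
set w := fun n => \sum_(k < n.+1) u k * v (n - k)%N.
(* Each of the n + 1 products is at most [C D / 4^n], and n + 1 is at most 2^n. *)
have wCD : dominated (C * D) w.
  move=> n; apply: le_trans (ler_normc_sum _ _ _) _.
  apply: (@le_trans _ _ (\sum_(k < n.+1) (C * D / 4%:R ^+ n))).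
    apply: ler_sum => k _; rewrite Normc.normcM.
    have kn : (k <= n)%N by rewrite -ltnS.
    rewrite -[X in _ ^+ X](subnKC kn) exprD invfM mulrACA.
    by rewrite ler_pM ?normc_ge0.
  rewrite sumr_const card_ord -[leLHS]mulr_natr expr4 invfM mulrA -[leLHS]mulrA.
  by rewrite ler_piMr ?divr_ge0 ?mulr_ge0 ?exprn_ge0 // -exprVn le_half_exp.
(* 8 = 4 + 4: the tail of [u] times [csum v] costs [2C * 2D], and the tails of [v] cost [2CD / 2^i]
   for each [i], in total [4CD]. *)
apply/esym; apply: (@csum_unique _ (8%:R * C * D) _ _ wCD) => N.
have -> : psum w N = \sum_(i < N) u i * psum v (N - i).
  elim: N => [|N IH]; first by rewrite /psum !big_ord0.
  rewrite [LHS]big_ord_recr -/(psum w N) IH big_ord_recr /= subSnn.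
  rewrite /w big_ord_recr /= subnn addrA; congr (_ + _); last first.
    by rewrite /psum big_ord1.
  rewrite -big_split /=; apply: eq_bigr => i _.
  rewrite -mulrDr; congr (_ * _); rewrite subSn ?(ltnW (ltn_ord i)) //.
  by rewrite [RHS]/psum big_ord_recr.
have -> : csum u * csum v - \sum_(i < N) u i * psum v (N - i) =
    (csum u - psum u N) * csum v + \sum_(i < N) u i * (csum v - psum v (N - i)).
  rewrite mulrBl -addrA; congr (_ + _).
  under [in RHS]eq_bigr do rewrite mulrBr.
  by rewrite sumrB -mulr_suml addrA addNr add0r.
apply: le_trans (le_normcD _ _) _.
have -> : 8%:R * C * D / 2%:R ^+ N =
    2%:R * C / 2%:R ^+ N * (2%:R * D) + (2%:R * C * D / 2%:R ^+ N) * 2%:R by ring.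
apply: lerD.
  rewrite Normc.normcM ler_pM ?normc_ge0 ?csum_le //.
  exact: csum_psum.
apply: le_trans (ler_normc_sum _ _ _) _.
apply: (@le_trans _ _ (\sum_(i < N) (2%:R * C * D / 2%:R ^+ N) / 2%:R ^+ i)).
  apply: ler_sum => i _; rewrite Normc.normcM.
  have -> : 2%:R * C * D / 2%:R ^+ N / 2%:R ^+ i =
      C / 4%:R ^+ i * (2%:R * D / 2%:R ^+ (N - i)).
    have -> : (2%:R : R) ^+ N = 2%:R ^+ (N - i) * 2%:R ^+ i.
      by rewrite -exprD subnK // ltnW.
    by rewrite expr4; field; rewrite !expf_neq0 ?pnatr_eq0.
  by rewrite ler_pM ?normc_ge0 //; exact: csum_psum.
apply: le_trans (half_psum_le (fun=> lexx _) N) _.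
rewrite ler_wpM2l ?gerBl ?divr_ge0 ?mulr_ge0 ?exprn_ge0 //.
Qed.
End ComplexSeries.

(** * Complex derivatives with quadratic remainder *)

Section ComplexDerivative.
Variable R : realType.
Implicit Types (F G : R[i] -> R[i]) (z y l c : R[i]).

(* A quadratic remainder is available for all the analytic functions at hand
   and makes the rules of calculus elementary. *)
Definition cderiv F z l := exists M d : R,
  [/\ 0 <= M, 0 < d & forall y, normc (y - z) < d ->
    normc (F y - F z - (y - z) * l) <= M * normc (y - z) ^+ 2].

Lemma cderiv_lipschitz F z l : cderiv F z l -> exists L d : R,
  [/\ 0 <= L, 0 < d & forall y, normc (y - z) < d ->
    normc (F y - F z) <= L * normc (y - z)].
Proof.
move=> [M [d [M0 d0 H]]]; exists (M + normc l), (Num.min d 1).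
split; [by rewrite addr_ge0 ?normc_ge0|by rewrite lt_min d0 ltr01|].
move=> y; rewrite lt_min => /andP[yd y1].
rewrite -(subrK ((y - z) * l) (F y - F z)); apply: le_trans (le_normcD _ _) _.
rewrite [leRHS]mulrDl lerD //; last by rewrite Normc.normcM mulrC.
apply: le_trans (H _ yd) _; rewrite ler_wpM2l // expr2.
by rewrite ler_piMl ?normc_ge0 // ltW.
Qed.

Lemma cderiv_cst c z : cderiv (fun=> c) z 0.
Proof.
exists 0, 1; split=> // y _.
by rewrite subrr mulr0 subr0 Normc.normc0 mul0r.
Qed.

Lemma cderivD F G z l l' : cderiv F z l -> cderiv G z l' ->
  cderiv (fun y => F y + G y) z (l + l').
Proof.
move=> [M [d [M0 d0 H]]] [M' [d' [M'0 d'0 H']]].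
exists (M + M'), (Num.min d d'); split; [exact: addr_ge0|by rewrite lt_min d0|].
move=> y; rewrite lt_min => /andP[yd yd'].
have -> : F y + G y - (F z + G z) - (y - z) * (l + l') =
  (F y - F z - (y - z) * l) + (G y - G z - (y - z) * l') by ring.
by apply: le_trans (le_normcD _ _) _; rewrite [leRHS]mulrDl lerD ?H ?H'.
Qed.

Lemma cderivM F G z l l' : cderiv F z l -> cderiv G z l' ->
  cderiv (fun y => F y * G y) z (l * G z + F z * l').
Proof.
move=> dF dG; have [L [e [L0 e0 HL]]] := cderiv_lipschitz dG.
move: dF dG => [M [d [M0 d0 H]]] [M' [d' [M'0 d'0 H']]].
exists (M * (L + normc (G z)) + normc (F z) * M' + normc l * L).
exists (Num.min (Num.min d d') (Num.min e 1)); split.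
- by rewrite !addr_ge0 ?mulr_ge0 ?addr_ge0 ?normc_ge0.
- by rewrite !lt_min d0 d'0 e0 ltr01.
move=> y; rewrite !lt_min => /andP[/andP[yd yd'] /andP[ye y1]].
have -> : F y * G y - F z * G z - (y - z) * (l * G z + F z * l') =
  (F y - F z - (y - z) * l) * G y + F z * (G y - G z - (y - z) * l') +
  l * (y - z) * (G y - G z) by ring.
rewrite [leRHS]mulrDl [X in _ <= X + _]mulrDl.
apply: le_trans (le_normcD _ _) _; apply: lerD.
  apply: le_trans (le_normcD _ _) _; apply: lerD; rewrite Normc.normcM.
    rewrite mulrAC ler_pM ?normc_ge0 ?H //.
    rewrite -(subrK (G z) (G y)); apply: le_trans (le_normcD _ _) _.
    rewrite lerD2r; apply: le_trans (HL _ ye) _.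
    by rewrite ler_piMr // ltW.
  by rewrite -mulrA ler_wpM2l ?normc_ge0 ?H'.
rewrite !Normc.normcM expr2 -!mulrA ler_wpM2l ?normc_ge0 // mulrCA.
by rewrite ler_wpM2l ?normc_ge0 ?HL.
Qed.

Lemma cderivZ c F z l : cderiv F z l -> cderiv (fun y => c * F y) z (c * l).
Proof. by move=> /(cderivM (cderiv_cst c z)); rewrite mul0r add0r. Qed.

Lemma cderivV z : z != 0 -> cderiv (fun y => y^-1) z (- z ^- 2).
Proof.
move=> z0; have nz : 0 < normc z.
  by rewrite lt_neqAle normc_ge0 andbT eq_sym; apply: contra z0 => /eqP/Normc.eq0_normc ->.
(* The remainder is [(y - z)^2 / (z^2 y)], and [|y| > |z| / 2] on the chosen disc. *)
exists ((normc z ^+ 2)^-1 * (2%:R / normc z)), (normc z / 2%:R).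
split; [by rewrite mulr_ge0 ?invr_ge0 ?divr_ge0 ?exprn_ge0 ?(ltW nz)|by rewrite divr_gt0|].
move=> y yz.
have ny : normc z / 2%:R < normc y.
  have := le_normcD (z - y) y; rewrite subrK normcB => le.
  by move: yz le; lra.
have ny0 : 0 < normc y by apply: lt_trans ny; rewrite divr_gt0.
have y0 : y != 0 by apply: contraTneq ny0 => ->; rewrite Normc.normc0 ltxx.
have -> : y^-1 - z^-1 - (y - z) * - z ^- 2 = (z ^+ 2)^-1 * y^-1 * (y - z) ^+ 2.
  by field; rewrite z0 y0.
rewrite !Normc.normcM !Normc.normcV !normcX ler_wpM2r ?mulr_ge0 ?exprn_ge0 ?normc_ge0 //.
rewrite ler_wpM2l ?invr_ge0 ?exprn_ge0 ?normc_ge0 //.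
by rewrite -[leRHS]invf_div lef_pV2 ?posrE ?divr_gt0 // ltW.
Qed.

Lemma cderivVX k z : z != 0 ->
  cderiv (fun y => y ^- k) z (- k%:R * z ^- k.+1).
Proof.
move=> z0; elim: k => [|k IH].
  rewrite oppr0 mul0r (_ : (fun y => y ^- 0) = fun=> 1); first exact: cderiv_cst.
  by apply/funext => y; rewrite expr0 invr1.
rewrite (_ : (fun y => y ^- k.+1) = fun y => y^-1 * y ^- k); last first.
  by apply/funext => y; rewrite exprS invfM.
have -> : - k.+1%:R * z ^- k.+2 = - z ^- 2 * z ^- k + z^-1 * (- k%:R * z ^- k.+1).
  rewrite -natr1 !exprS; field.
  by rewrite z0 expf_neq0.
exact: cderivM (cderivV z0) IH.
Qed.

Lemma cderiv_sum n (c : nat -> R[i]) (F : nat -> R[i] -> R[i]) (l : nat -> R[i]) z :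
  (forall k, cderiv (F k) z (l k)) ->
  cderiv (fun y => \sum_(k < n) c k * F k y) z (\sum_(k < n) c k * l k).
Proof.
move=> H; elim: n => [|n IH].
  rewrite big_ord0 (_ : (fun y => _) = fun=> 0); first exact: cderiv_cst.
  by apply/funext => y; rewrite big_ord0.
rewrite big_ord_recr (_ : (fun y => _) =
  fun y => \sum_(k < n) c k * F k y + c n * F n y); last first.
  by apply/funext => y; rewrite big_ord_recr.
by apply: cderivD => //; exact: cderivZ.
Qed.

Lemma deriveCE F z l : cderiv F z l -> deriveC F z = l.
Proof.
move=> [M [d [M0 d0 H]]]; apply: (@cvg_lim R[i]^o) => //.
apply/(@cvgrPdist_le R[i] R[i]^o) => e e0.
have eE : e = (complex.Re e)%:C%C.
  by move: e0; rewrite ltcE /= => /andP[/eqP ei _]; case: e ei => a b /= ->.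
have e0' : 0 < complex.Re e by rewrite -ltcR -eE.
pose d' := Num.min d (complex.Re e / (M + 1)).
have d'0 : 0 < d' by rewrite lt_min d0 divr_gt0 // ltr_wpDl.
have d'C : 0 < d'%:C%C :> R[i] by rewrite -[0]/(0%:C%C) ltcR.
have near0 := @nbhs0_lt R[i] R[i]^o _ d'C.
rewrite /dnbhs /within /=; apply: filterS near0 => h /= hd h0.
have {}hd : normc h < d' by rewrite -ltcR -normr_normc.
move: hd; rewrite lt_min => /andP[hd he].
have := H (h + z); rewrite addrK => /(_ hd) H1.
have hn : 0 < normc h.
  by rewrite lt_neqAle normc_ge0 andbT eq_sym; apply: contra h0 => /eqP/Normc.eq0_normc ->.
rewrite distrC normr_normc eE lecR /=.
have -> : h^-1 *: (F (h + z) - F z) - l = h^-1 * (F (h + z) - F z - h * l).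
  by rewrite mulrBr mulKf.
rewrite Normc.normcM Normc.normcV mulrC ler_pdivrMr //.
apply: le_trans H1 _; rewrite expr2 mulrA ler_wpM2r ?normc_ge0 //.
move: he; rewrite ltr_pdivlMr ?ltr_wpDl // => he.
by have := normc_ge0 h; nra.
Qed.

End ComplexDerivative.

(** * Power series and termwise differentiation *)

Section PowerSeries.
Variable R : realType.
Implicit Types (a : nat -> R[i]) (y z : R[i]) (C K : R).

Definition pser a z := csum (fun n => a n * z ^+ n).

Definition geometric_le C K a := forall n, normc (a n) <= C * K ^+ n.

Definition dcoef a n := n.+1%:R * a n.+1.

Lemma geometric_le_term C K a z n : 0 <= K -> geometric_le C K a ->
  K * normc z <= 4%:R^-1 -> normc (a n * z ^+ n) <= C / 4%:R ^+ n.
Proof.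
move=> K0 aC Kz.
have C0 : 0 <= C by have := aC 0; rewrite expr0 mulr1; apply: le_trans; exact: normc_ge0.
rewrite Normc.normcM normcX; apply: le_trans (ler_wpM2r _ (aC n)) _.
  by rewrite exprn_ge0 ?normc_ge0.
rewrite -mulrA -exprMn -exprVn ler_wpM2l // lerXn2r ?nnegrE ?mulr_ge0 ?normc_ge0 //.
Qed.

Lemma geometric_le_ge0 C K a : geometric_le C K a -> 0 <= C.
Proof. by move=> /(_ 0); rewrite expr0 mulr1; apply: le_trans; exact: normc_ge0. Qed.

Lemma pser_dominated C K a z : 0 <= K -> geometric_le C K a ->
  K * normc z <= 4%:R^-1 -> dominated C (fun n => a n * z ^+ n).
Proof.
move=> K0 aC Kz n; apply: le_trans (geometric_le_term n K0 aC Kz) _.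
exact: le_quarter_half (geometric_le_ge0 aC).
Qed.

(** The factor n + 1 is absorbed by 2^n, at the price of doubling [K]. *)
Lemma dcoef_geometric C K a : 0 <= K -> geometric_le C K a ->
  geometric_le (C * K) (2%:R * K) (dcoef a).
Proof.
move=> K0 aC n; rewrite Normc.normcM normc_nat.
have C0 := geometric_le_ge0 aC.
apply: le_trans (ler_wpM2l (ler0n _ _) (aC n.+1)) _.
rewrite exprS exprMn [leLHS]mulrCA [C * K * _]mulrA -!mulrA ler_wpM2l //.
rewrite mulrCA ler_wpM2l // [leRHS]mulrC [leLHS]mulrC ler_wpM2l ?exprn_ge0 //.
by rewrite -natrX ler_nat ltn_expl.
Qed.

(** Having [rho ^+ 2] on the left avoids the exponent n - 2. The remainder for n + 1 is [y] times
    the one for n plus [n z^(n-1) (y - z)^2], and [n^2 + n <= (n + 1)^2]. *)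
Lemma pow_taylor_le (rho : R) y z n : 0 <= rho ->
  normc y <= rho -> normc z <= rho ->
  rho ^+ 2 * normc (y ^+ n - z ^+ n - (y - z) * (n%:R * z ^+ n.-1)) <=
  n%:R ^+ 2 * rho ^+ n * normc (y - z) ^+ 2.
Proof.
move=> r0 yr zr; elim: n => [|n IH].
  by rewrite !expr0 subrr !mul0r mulr0 subr0 Normc.normc0 expr0n !mul0r mulr0.
have zn : n%:R * z ^+ n = z * (n%:R * z ^+ n.-1).
  by case: n {IH} => [|n]; rewrite ?mul0r ?mulr0 //= exprS mulrCA.
have -> : y ^+ n.+1 - z ^+ n.+1 - (y - z) * (n.+1%:R * z ^+ n.+1.-1) =
    y * (y ^+ n - z ^+ n - (y - z) * (n%:R * z ^+ n.-1)) +
    n%:R * z ^+ n.-1 * (y - z) ^+ 2.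
  rewrite /= -natr1 [(n%:R + 1) * _]mulrDl zn !exprS mul1r.
  by move: (n%:R * z ^+ n.-1) => t; rewrite expr0; ring.
apply: le_trans (ler_wpM2l (exprn_ge0 _ r0) (le_normcD _ _)) _.
rewrite mulrDr.
have h1 : rho ^+ 2 * normc (y * (y ^+ n - z ^+ n - (y - z) * (n%:R * z ^+ n.-1)))
   <= rho * (n%:R ^+ 2 * rho ^+ n * normc (y - z) ^+ 2).
  by rewrite Normc.normcM mulrCA ler_pM ?mulr_ge0 ?normc_ge0 ?exprn_ge0.
have h2 : rho ^+ 2 * normc (n%:R * z ^+ n.-1 * (y - z) ^+ 2) <=
   n%:R * rho ^+ n.+1 * normc (y - z) ^+ 2.
  rewrite 2!Normc.normcM normc_nat !normcX mulrA ler_wpM2r ?exprn_ge0 ?normc_ge0 //.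
  case: n {IH zn h1} => [|n /=]; first by rewrite !mul0r mulr0.
  rewrite mulrCA ler_wpM2l // [leRHS](_ : _ = rho ^+ 2 * rho ^+ n); last by rewrite -exprD.
  by rewrite ler_wpM2l ?exprn_ge0 // lerXn2r ?nnegrE ?normc_ge0.
apply: le_trans (lerD h1 h2) _.
rewrite mulrA -mulrDl ler_wpM2r ?exprn_ge0 ?normc_ge0 //.
rewrite mulrCA -exprS -mulrDl ler_wpM2r ?exprn_ge0 // -natr1.
have : (0 : R) <= n%:R by [].
by nra.
Qed.

(** The factor 2 is forced by n = 3; from 4 on, [(n + 1)^2 <= 2 n^2] drives the induction. *)
Lemma sqrn_le_exp n : (n ^ 2 <= 2 * 2 ^ n)%N.
Proof.
have [|n3] := leqP n 3; first by case: n => [|[|[|[|]]]].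
rewrite -(subnK n3); elim: (n - 4)%N => // k IH.
rewrite addSn; have : ((k + 4).+1 ^ 2 <= 2 * (k + 4) ^ 2)%N.
  by rewrite -!mulnn; nia.
by move=> le; apply: leq_trans le _; rewrite leq_mul2l /= [X in (_ <= X)%N]expnS.
Qed.

Lemma pser_deriv_csum C K a z : 0 <= K -> geometric_le C K a ->
  K * normc z <= 4%:R^-1 ->
  dominated (2%:R * C * K) (fun n => a n * (n%:R * z ^+ n.-1)) /\
  csum (fun n => a n * (n%:R * z ^+ n.-1)) = pser (dcoef a) z.
Proof.
move=> K0 aC Kz; have C0 := geometric_le_ge0 aC.
have dom : dominated (2%:R * C * K) (fun n => a n * (n%:R * z ^+ n.-1)).
  case=> [|n]; first by rewrite mul0r mulr0 Normc.normc0 divr_ge0 ?mulr_ge0.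
  rewrite /= mulrCA mulrA.
  rewrite Normc.normcM; apply: le_trans (ler_wpM2r (normc_ge0 _) (dcoef_geometric K0 aC n)) _.
  rewrite normcX -[leLHS]mulrA -exprMn exprS invfM.
  rewrite -[2%:R * C * K]mulrA [leRHS]mulrACA divff ?pnatr_eq0 // mul1r.
  rewrite ler_wpM2l ?mulr_ge0 // -exprVn lerXn2r ?nnegrE ?mulr_ge0 ?normc_ge0 //.
  by rewrite -mulrA; lra.
(* The term of index 0, where [n.-1] is 0 by convention, vanishes through its factor n. *)
split=> //; rewrite (csum_split 1 dom) /psum big_ord1 mul0r mulr0 add0r.
by apply: eq_csum => n; rewrite add1n /= mulrCA mulrA.
Qed.

(** [pow_taylor_le] is applied with [rho = 1/(4K)]. The constant is 16 from [rho^-2 = 16 K^2],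
    doubled by [n^2 / 4^n <= 2 / 2^n] and doubled again by [csum_le]. *)
Lemma pser_taylor C K a y z : 0 < K -> geometric_le C K a ->
  K * normc y <= 4%:R^-1 -> K * normc z <= 4%:R^-1 ->
  normc (pser a y - pser a z - (y - z) * pser (dcoef a) z) <=
  64%:R * C * K ^+ 2 * normc (y - z) ^+ 2.
Proof.
move=> K0 aC Ky Kz; have C0 := geometric_le_ge0 aC.
have K0' := ltW K0.
have [dom <-] := pser_deriv_csum K0' aC Kz.
have domy := pser_dominated K0' aC Ky; have domz := pser_dominated K0' aC Kz.
rewrite /pser -mulNr -(csumZ _ dom) -[- csum _]mulN1r -(csumZ (-1) domz).
rewrite -(csumD domy (dominatedZ _ domz)).
rewrite -(csumD (dominatedD domy (dominatedZ _ domz)) (dominatedZ _ dom)).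
have -> : 64%:R * C * K ^+ 2 * normc (y - z) ^+ 2 =
  2%:R * (32%:R * C * K ^+ 2 * normc (y - z) ^+ 2) by ring.
apply: csum_le => n.
have -> : a n * y ^+ n + -1 * (a n * z ^+ n) + - (y - z) * (a n * (n%:R * z ^+ n.-1)) =
  a n * (y ^+ n - z ^+ n - (y - z) * (n%:R * z ^+ n.-1)) by ring.
pose rho : R := (4%:R * K)^-1.
have r0 : 0 < rho by rewrite invr_gt0 mulr_gt0.
have rE x : (normc x <= rho) = (K * normc x <= 4%:R^-1) :> bool.
  by rewrite /rho invfM ler_pdivlMr // mulrC.
have := @pow_taylor_le rho y z n (ltW r0).
rewrite !rE => /(_ Ky Kz).
set D := normc (_ - _ * (n%:R * _)); set h := normc (y - z) ^+ 2 => DH.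
rewrite Normc.normcM -/D; apply: le_trans (ler_wpM2r (normc_ge0 _) (aC n)) _.
have Kr : K ^+ n * rho ^+ n = (4%:R ^+ n)^-1.
  by rewrite -exprMn /rho invfM mulrCA divff ?gt_eqF // mulr1 exprVn.
have r2 : rho ^+ 2 = (16%:R * K ^+ 2)^-1 by rewrite /rho exprVn exprMn -natrX.
have n2 : n%:R ^+ 2 / 4%:R ^+ n <= 2%:R / 2%:R ^+ n :> R.
  rewrite expr4 invfM mulrA ler_wpM2r ?invr_ge0 ?exprn_ge0 //.
  by rewrite ler_pdivrMr ?exprn_gt0 // -!natrX -natrM ler_nat sqrn_le_exp.
have DH' : D <= (16%:R * K ^+ 2) * (n%:R ^+ 2 * rho ^+ n * h).
  by rewrite -ler_pdivrMl ?mulr_gt0 ?exprn_gt0 // -r2.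
have KK : 0 <= C * K ^+ n by rewrite mulr_ge0 ?exprn_ge0.
apply: le_trans (ler_wpM2l KK DH') _.
have -> : C * K ^+ n * (16%:R * K ^+ 2 * (n%:R ^+ 2 * rho ^+ n * h)) =
  (16%:R * C * K ^+ 2 * h) * (n%:R ^+ 2 * (K ^+ n * rho ^+ n)) by ring.
rewrite Kr.
have -> : 32%:R * C * K ^+ 2 * h / 2%:R ^+ n =
  (16%:R * C * K ^+ 2 * h) * (2%:R / 2%:R ^+ n) by ring.
by rewrite ler_wpM2l // ?mulr_ge0 ?exprn_ge0 ?normc_ge0.
Qed.

Lemma pser_cderiv C K a z : 0 < K -> geometric_le C K a ->
  K * normc z < 4%:R^-1 -> cderiv (pser a) z (pser (dcoef a) z).
Proof.
move=> K0 aC Kz; exists (64%:R * C * K ^+ 2), ((4%:R^-1 - K * normc z) / K).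
split; first by rewrite !mulr_ge0 ?exprn_ge0 ?(geometric_le_ge0 aC) ?(ltW K0).
  by rewrite divr_gt0 // subr_gt0.
move=> y; rewrite ltr_pdivlMr // => yz.
apply: pser_taylor => //; last exact: ltW.
have := le_normcD (y - z) z; rewrite subrK => le.
by nra.
Qed.

End PowerSeries.

(** * Integration along piecewise smooth curves *)

Section PiecewiseIntegral.
Variable R : realType.
Implicit Types (f g d Phi : R -> R) (a b c : R).
Notation mu := (@lebesgue_measure R).

(** At the breakpoints of a curve [derive_path] need not be meaningful; the endpoints of a piece are
    a null set, so the continuous extension [d] decides the integral. *)
Lemma eq_oo_integrable f d a b :
  mu.-integrable `[a, b] (EFin \o d) -> {in `]a, b[, f =1 d} ->
  mu.-integrable `[a, b] (EFin \o f) /\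
  (\int[mu]_(t in `[a, b]) f t = \int[mu]_(t in `[a, b]) d t)%R.
Proof.
move=> id fd.
have fd' : {in `]a, b[%classic, (EFin \o f) =1 (EFin \o d)}.
  by move=> t; rewrite inE /= => tab; congr EFin; exact: fd.
have /integrableP[md dfin] := id.
have mdo : measurable_fun `]a, b[ (EFin \o d).
  by apply: measurable_funS md => //; exact: subset_itv_oo_cc.
have mfo : measurable_fun `]a, b[ (EFin \o f).
  by apply: eq_measurable_fun mdo => t tab; exact/esym/fd'.
have mf : measurable_fun `[a, b] (EFin \o f) := emeasurable_fun_itv_cc mfo.
split.
  apply/integrableP; split=> //.
  rewrite integral_itv_bndoo; last by apply: measurableT_comp.
  have -> : (\int[mu]_(t in `]a, b[) `|(EFin \o f) t| =
      \int[mu]_(t in `]a, b[) `|(EFin \o d) t|)%E.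
    by apply: eq_integral => t tab; rewrite fd'.
  by rewrite -(@integral_itv_bndoo _ a b _ true false) //; apply: measurableT_comp.
rewrite /Rintegral; congr fine.
have -> : (\int[mu]_(t in `[a, b]) (f t)%:E = \int[mu]_(t in `]a, b[) (f t)%:E)%E.
  exact: integral_itv_bndoo.
have -> : (\int[mu]_(t in `[a, b]) (d t)%:E = \int[mu]_(t in `]a, b[) (d t)%:E)%E.
  exact: integral_itv_bndoo.
by apply: eq_integral => t tab; exact: fd'.
Qed.

Lemma integrable_cat f a b c : a <= c -> c <= b ->
  mu.-integrable `[a, c] (EFin \o f) -> mu.-integrable `[c, b] (EFin \o f) ->
  mu.-integrable `[a, b] (EFin \o f) /\
  (\int[mu]_(t in `[a, b]) f t =
   \int[mu]_(t in `[a, c]) f t + \int[mu]_(t in `[c, b]) f t)%R.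
Proof.
move=> ac cb i1 i2.
have i1' : mu.-integrable `[a, c[ (EFin \o f).
  by apply: integrableS i1 => //; apply: subset_itvl; rewrite bnd_simp.
have E : `[a, b]%classic = `[a, c[%classic `|` `[c, b]%classic.
  by apply: itv_bndbnd_setU; rewrite bnd_simp.
have dis : [disjoint `[a, c[%classic & `[c, b]%classic].
  apply/disj_setPS => y [/=]; rewrite !in_itv /= => /andP[_ yc] /andP[].
  by rewrite leNgt yc.
have iab : mu.-integrable `[a, b] (EFin \o f).
  have /integrableP[m1 f1] := i1'; have /integrableP[m2 f2] := i2.
  have mU : measurable_fun (`[a, c[%classic `|` `[c, b]%classic) (EFin \o f).
    by apply/measurable_funU.
  apply/integrableP; rewrite E; split=> //.
  rewrite ge0_integral_setU //; first exact: lte_add_pinfty.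
  exact: (measurableT_comp (@abse_measurable R setT) mU).
split=> //; rewrite E Rintegral_setU -?E //.
by rewrite Rintegral_itv_bndo_bndc.
Qed.

Definition piecewise (s : seq R) (a : R) (P : R -> R -> Prop) :=
  path <%R a s /\ forall k, (k < size s)%N -> P (nth 0 (a :: s) k) (nth 0 s k).

(** Passes from the pieces to the whole interval; it serves integrability, the fundamental theorem
    and the bounds on breakpoints. *)
Lemma piecewise_ind (P Q : R -> R -> Prop) s a :
  (forall x y, x < y -> P x y -> Q x y) ->
  (forall x, Q x x) ->
  (forall x y z, x < y -> y <= z -> Q x y -> Q y z -> Q x z) ->
  piecewise s a P -> a <= last a s /\ Q a (last a s).
Proof.
move=> PQ Q0 QD; elim: s a => [|x s IH] a [/= sa H].
  by split.
have /andP[ax xs] := sa.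
have [|xl Ql] := IH x; first by split=> // k ks; exact: (H k.+1).
split; first by apply: le_trans xl; exact: ltW.
by apply: QD Ql => //; apply: PQ => //; exact: (H 0).
Qed.

Definition continuous_piece f a b := exists d,
  {within `[a, b], continuous d} /\ forall t, t \in `]a, b[ -> f t = d t.

Lemma piecewise_continuous_integrable f s a :
  piecewise s a (continuous_piece f) ->
  mu.-integrable `[a, last a s] (EFin \o f).
Proof.
move=> pf.
apply: (proj2 (@piecewise_ind (continuous_piece f)
  (fun x y => mu.-integrable `[x, y] (EFin \o f)) s a _ _ _ pf)).
- move=> x y xy [d [dc fd]].
  apply: (proj1 (@eq_oo_integrable f d x y _ fd)).
  by apply: continuous_compact_integrable => //; exact: segment_compact.
- move=> x; rewrite set_itv1.
  by apply: null_set_integrable => //; [exact: measurable_fun_set1 |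
    exact: lebesgue_measure_set1].
- by move=> x y z /ltW xy yz i1 i2; have [] := integrable_cat xy yz i1 i2.
Qed.

Definition primitive_piece f Phi a b := exists d,
  {within `[a, b], continuous d} /\
  forall t, t \in `]a, b[ -> f t = d t /\ is_derive t 1 Phi (d t).

Lemma piecewise_FTC f Phi s a :
  {within `[a, last a s], continuous Phi} ->
  piecewise s a (primitive_piece f Phi) ->
  mu.-integrable `[a, last a s] (EFin \o f) /\
  (\int[mu]_(t in `[a, last a s]) f t = Phi (last a s) - Phi a)%R.
Proof.
move=> Phic pf.
apply: (proj2 (@piecewise_ind (primitive_piece f Phi) (fun x y =>
  {within `[x, y], continuous Phi} ->
  mu.-integrable `[x, y] (EFin \o f) /\
  (\int[mu]_(t in `[x, y]) f t = Phi y - Phi x)%R) s a _ _ _ pf) Phic).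
- move=> x y xy [d [dc H]] Pc.
  have id : mu.-integrable `[x, y] (EFin \o d).
    by apply: continuous_compact_integrable => //; exact: segment_compact.
  have [|i ->] := @eq_oo_integrable f d x y id.
    by move=> t /H[].
  split=> //; rewrite /Rintegral (@continuous_FTC2 _ d Phi) //.
    have [_ Pr Pl] := (continuous_within_itvP Phi xy).1 Pc.
    by split=> // t txy; have [_ []] := H t txy.
  by move=> t txy; have [_ Pd] := H t txy; rewrite derive1E; apply: derive_val.
- move=> x _; rewrite set_itv1 Rintegral_set1 subrr; split=> //.
  by apply: null_set_integrable => //; [exact: measurable_fun_set1 |
    exact: lebesgue_measure_set1].
- move=> x y z /ltW xy yz H1 H2 Pc.
  have [|i1 e1] := H1.
    by apply: continuous_subspaceW Pc; apply: subset_itvl; rewrite bnd_simp.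
  have [|i2 e2] := H2.
    by apply: continuous_subspaceW Pc; apply: subset_itvr; rewrite bnd_simp.
  have [i ->] := integrable_cat xy yz i1 i2.
  by split=> //; rewrite e1 e2 addrC subrKA.
Qed.

End PiecewiseIntegral.

Section Paths.
Variable R : realType.
Implicit Types (gam : R -> R[i]) (F : R[i] -> R[i]) (t : R) (l z : R[i]).
Notation Re := complex.Re.
Notation Im := complex.Im.

Lemma is_derive_squeeze0 (e b : R -> R) t :
  (\forall s \near t, `|e s| <= b s) -> b t = 0 -> is_derive t 1 b 0 ->
  is_derive t 1 e 0.
Proof.
move=> eb bt [db bval].
have et : e t = 0.
  by have /nbhs_singleton := eb; rewrite bt normr_le0 => /eqP.
suff cv : h^-1 *: (e (h *: 1 + t) - e t) @[h --> 0^'] --> (0 : R).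
  by apply: DeriveDef; [exact: cvgP cv | exact: cvg_lim cv].
have : h^-1 *: (b (h *: 1 + t) - b t) @[h --> 0^'] --> ('D_1 b t : R) := db.
rewrite bval et bt => /cvgrPdist_lt bcv; apply/cvgrPdist_lt => x x0.
have /nbhs_ballP[r /= r0 br] := eb.
near=> h.
have hb : `|e (h *: 1 + t)| <= b (h *: 1 + t).
  apply: br; rewrite -ball_normE /= opprD addrCA subrr addr0 normrN /GRing.scale /= mulr1.
  by near: h; apply: dnbhs0_lt.
have : `|0 - h^-1 *: (b (h *: 1 + t) - 0)| < x by near: h; exact: bcv.
rewrite !subr0 !sub0r !normrN; apply: le_lt_trans.
by rewrite !normrM ler_wpM2l // (le_trans hb) // ler_norm.
Unshelve. all: by end_near. Qed.

Lemma normc_sqr z : normc z ^+ 2 = Re z ^+ 2 + Im z ^+ 2.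
Proof. by case: z => a b; rewrite sqr_sqrtr // addr_ge0 ?sqr_ge0. Qed.

(* The remainder of the first order expansion of [F \o gam] is squeezed by
   [M * |gam s - gam t|^2], whose derivative vanishes at [t]. *)
Lemma Re_cderiv_path gam F l t (d1 d2 : R) :
  is_derive t 1 (fun s => Re (gam s)) d1 ->
  is_derive t 1 (fun s => Im (gam s)) d2 ->
  cderiv F (gam t) l ->
  is_derive t 1 (fun s => Re (F (gam s))) (Re (l * Complex d1 d2)).
Proof.
move=> D1 D2 [M [d [M0 d0 H]]].
pose x := fun s => Re (gam s); pose y := fun s => Im (gam s).
pose b := fun s => M * ((x s - x t) ^+ 2 + (y s - y t) ^+ 2).
pose p := fun s => Re (F (gam t)) + (Re l * (x s - x t) - Im l * (y s - y t)).
pose e := fun s => Re (F (gam s)) - p s.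
have Db : is_derive t 1 b 0.
  rewrite /b; apply: is_derive_eq.
  by rewrite !subrr; rewrite !(scaler0, scale0r, mul0r, mulr0, addr0, expr1, mul0rn).
have Dp : is_derive t 1 p (Re (l * Complex d1 d2)).
  rewrite /p; apply: is_derive_eq.
  by rewrite add0r mul1r !subr0; case: (l).
have eE s : e s = Re (F (gam s) - F (gam t) - (gam s - gam t) * l).
  rewrite /e /p /x /y [RHS]raddfB [X in _ = X - _]raddfB /=.
  move: (Re (F (gam s))) (Re (F (gam t))) => A B.
  by case: (gam s) (gam t) (l) => [u1 u2] [v1 v2] [l1 l2] /=; ring.
have bE s : b s = M * normc (gam s - gam t) ^+ 2 by rewrite normc_sqr !raddfB.
have De : is_derive t 1 e 0.
  apply: (@is_derive_squeeze0 e b) => //; last first.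
    by rewrite /b !subrr expr0n /= addr0 mulr0.
  have cx : {for t, continuous x}.
    by apply: differentiable_continuous; apply/derivable1_diffP; case: D1.
  have cy : {for t, continuous y}.
    by apply: differentiable_continuous; apply/derivable1_diffP; case: D2.
  have d20 : 0 < d / 2%:R by rewrite divr_gt0.
  have /cvgrPdist_lt/(_ _ d20) nx := cx.
  have /cvgrPdist_lt/(_ _ d20) ny := cy.
  near=> s.
  have lt : normc (gam s - gam t) < d.
    apply: le_lt_trans (ler_normc_ReIm _) _; rewrite [X in _ < X](splitr d).
    by apply: ltrD; rewrite raddfB /= distrC; near: s.
  rewrite eE bE; apply: le_trans (ler_Re_normc _) _; exact: H.
rewrite (_ : (fun s => _) = p \+ e); last first.
  by apply/funext => s; rewrite /e /= addrCA subrr addr0.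
rewrite -[X in is_derive _ _ _ X]addr0.
exact: is_deriveD.
Unshelve. all: by end_near. Qed.

Lemma Im_Re z : Im z = Re (- 'i%C * z).
Proof. by case: z => a b /=; rewrite !(oppr0, mul0r, sub0r, mulN1r, opprK). Qed.

Lemma Im_cderiv_path gam F l t (d1 d2 : R) :
  is_derive t 1 (fun s => Re (gam s)) d1 ->
  is_derive t 1 (fun s => Im (gam s)) d2 ->
  cderiv F (gam t) l ->
  is_derive t 1 (fun s => Im (F (gam s))) (Im (l * Complex d1 d2)).
Proof.
move=> D1 D2 /(cderivZ (- 'i%C)) /(Re_cderiv_path D1 D2).
rewrite -mulrA -Im_Re; congr is_derive.
by apply/funext => s; rewrite -Im_Re.
Qed.

Lemma derive_pathE gam t (d1 d2 : R) :
  is_derive t 1 (fun s => Re (gam s)) d1 ->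
  is_derive t 1 (fun s => Im (gam s)) d2 -> derive_path gam t = Complex d1 d2.
Proof.
move=> D1 D2; rewrite /derive_path !derive1E.
by rewrite (@derive_val _ _ _ _ _ _ _ D1) (@derive_val _ _ _ _ _ _ _ D2).
Qed.

Lemma derive_path_comp gam F l t (d1 d2 : R) :
  is_derive t 1 (fun s => Re (gam s)) d1 ->
  is_derive t 1 (fun s => Im (gam s)) d2 ->
  cderiv F (gam t) l -> derive_path (F \o gam) t = l * Complex d1 d2.
Proof.
move=> D1 D2 DF.
rewrite (derive_pathE (Re_cderiv_path D1 D2 DF) (Im_cderiv_path D1 D2 DF)).
by case: (l * _).
Qed.

Definition path_continuous (D : set R) gam :=
  {within D, continuous (fun t => Re (gam t))} /\
  {within D, continuous (fun t => Im (gam t))}.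

Lemma path_continuousW (D D' : set R) gam : D `<=` D' ->
  path_continuous D' gam -> path_continuous D gam.
Proof. by move=> DD [c1 c2]; split; exact: continuous_subspaceW DD _. Qed.

Lemma path_continuousM (D : set R) gam1 gam2 :
  path_continuous D gam1 -> path_continuous D gam2 ->
  path_continuous D (fun t => gam1 t * gam2 t).
Proof.
move=> [/subspace_continuousP a1 /subspace_continuousP b1].
move=> [/subspace_continuousP a2 /subspace_continuousP b2].
have ReM (z w : R[i]) : Re (z * w) = Re z * Re w - Im z * Im w by case: z; case: w.
have ImM (z w : R[i]) : Im (z * w) = Re z * Im w + Im z * Re w by case: z; case: w.
split; apply/subspace_continuousP => t Dt.
  under eq_fun do rewrite ReM.
  by apply: cvgB; apply: cvgM; [exact: a1|exact: a2|exact: b1|exact: b2].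
under eq_fun do rewrite ImM.
by apply: cvgD; apply: cvgM; [exact: a1|exact: b2|exact: b1|exact: a2].
Qed.

Lemma path_continuous_comp (D : set R) gam F (l : R -> R[i]) :
  path_continuous D gam -> (forall t, D t -> cderiv F (gam t) (l t)) ->
  path_continuous D (fun t => F (gam t)).
Proof.
move=> [/subspace_continuousP a /subspace_continuousP b] DF.
suff H t (x : R) : D t -> 0 < x ->
    \forall s \near within D (nbhs t), normc (F (gam s) - F (gam t)) < x.
  split; apply/subspace_continuousP => t Dt; apply/cvgrPdist_lt => x x0;
    apply: filterS (H t x Dt x0) => s; apply: le_lt_trans; rewrite distrC -raddfB.
  - exact: ler_Re_normc.
  - exact: ler_Im_normc.
move=> Dt x0; have [L [d [L0 d0 HL]]] := cderiv_lipschitz (DF t Dt).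
pose d' := Num.min d (x / (L + 1)).
have d'0 : 0 < d' by rewrite lt_min d0 divr_gt0 // ltr_wpDl.
have d20 : 0 < d' / 2%:R by rewrite divr_gt0.
have /cvgrPdist_lt/(_ _ d20) na := a t Dt.
have /cvgrPdist_lt/(_ _ d20) nb := b t Dt.
apply: filterS2 na nb => s na nb.
have : normc (gam s - gam t) < d'.
  apply: le_lt_trans (ler_normc_ReIm _) _; rewrite [X in _ < X](splitr d').
  by apply: ltrD; rewrite raddfB /= distrC.
rewrite lt_min => /andP[sd sx].
apply: le_lt_trans (HL _ sd) _.
move: sx; rewrite ltr_pdivlMr ?ltr_wpDl // => sx.
have := normc_ge0 (gam s - gam t); nra.
Qed.

End Paths.

Section CurveIntegral.
Variable R : realType.
Implicit Types (gam : R -> R[i]).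
Notation Re := complex.Re.
Notation Im := complex.Im.
Notation mu := (@lebesgue_measure R).

Lemma path_nth_bounds (s : seq R) a k : path <%R a s -> (k < size s)%N ->
  a <= nth 0 (a :: s) k /\ nth 0 s k <= last a s.
Proof.
elim: s a k => // x s IH a [|k] /= /andP[ax xs] ks.
  split=> //; case: s xs {IH ks} => //= y s /andP[xy ys].
  have [] := @piecewise_ind R (fun _ _ => True) (fun _ _ => True) (y :: s) x _ _ _ _ => //.
  by split=> //=; rewrite xy.
have [xk kl] := IH x k xs ks; split=> //.
by apply: le_trans xk; exact: ltW.
Qed.

(** The difference [f - c g] integrates to the increment of [Phi], which is zero; integrability of
    [f] is recovered from that of [f - c g] and [g]. *)
Lemma Rintegral_modulo_primitive (f g Phi : R -> R) (c : R) s a :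
  piecewise s a (continuous_piece g) ->
  piecewise s a (primitive_piece (fun t => f t - c * g t) Phi) ->
  {within `[a, last a s], continuous Phi} -> Phi a = Phi (last a s) ->
  (\int[mu]_(t in `[a, last a s]) f t = c * \int[mu]_(t in `[a, last a s]) g t)%R.
Proof.
move=> pg pf Phic Phi0.
have ig := piecewise_continuous_integrable pg.
have [ie ee] := piecewise_FTC Phic pf.
rewrite -RintegralZl // -[RHS]add0r -[X in X + _](subrr (Phi a)) [X in X - _]Phi0 -ee.
rewrite -RintegralD //; last first.
  by apply: eq_integrable (integrableZl _ c ig) => // t _; rewrite EFinM.
by apply: eq_Rintegral => t _; rewrite subrK.
Qed.

(** A residue theorem for [c / z + Q'(z)]: [Q] returns to its value around the loop, and the winding
    number evaluates the rest. [k] is prescribed only where the curve is differentiable. *)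
Lemma integral01_residue gam (r : R) (k : R -> R[i]) (c : R) (Q q : R[i] -> R[i]) :
  small_loop_around0 r gam ->
  (forall z, z != 0 -> normc z < r -> cderiv Q z (q z)) ->
  (forall z, z != 0 -> normc z < r -> exists l, cderiv q z l) ->
  (forall t d1 d2 : R, t \in `[0, 1] ->
     is_derive t 1 (fun s => Re (gam s)) d1 ->
     is_derive t 1 (fun s => Im (gam s)) d2 ->
     k t = (c%:C%C * (gam t)^-1 + q (gam t)) * Complex d1 d2) ->
  integral01 k = c%:C%C * Complex 0 (2 * pi).
Proof.
move=> [[cR cI [s [ps s1 pieces]]] [gam01 _] [gam0 wind] small] DQ Dq Hk.
have itv01 (t : R) : t \in `[(0 : R), 1] -> gam t != 0 /\ normc (gam t) < r.
  by move=> t01; split; [exact: gam0|exact: small].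
have cgam : path_continuous `[0, last 0 s] gam by rewrite s1.
(* Differentiability of [q] serves its continuity along the curve; the derivative is chosen as a
   function of [t], with value 0 off the unit interval. *)
have [l cq] : exists l, forall t : R, t \in `[(0 : R), 1] -> cderiv q (gam t) (l t).
  have /choice[l Hl] : forall t : R, exists l, t \in `[(0 : R), 1] -> cderiv q (gam t) l.
    move=> t; case: (boolP (t \in `[(0 : R), 1])) => t01; last by exists 0.
    by have [n0 nr] := itv01 t t01; have [l Hl] := Dq _ n0 nr; exists l.
  by exists l.
have cqg : path_continuous `[0, last 0 s] (fun t => q (gam t)).
  by rewrite s1; apply: (path_continuous_comp (l := l)) => //; rewrite -s1.
have cQg : path_continuous `[0, last 0 s] (fun t => Q (gam t)).
  rewrite s1; apply: (path_continuous_comp (l := q \o gam)); rewrite -?s1 //.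
  by rewrite s1 => t /itv01[]; exact: DQ.
have cVg : path_continuous `[0, last 0 s] (fun t => (gam t)^-1).
  rewrite s1; apply: (path_continuous_comp (F := GRing.inv) (l := fun t => - gam t ^- 2)).
    by rewrite -s1.
  by move=> t /itv01[] ? _; exact: cderivV.
pose k0 t := (gam t)^-1 * derive_path (id \o gam) t.
have windE : integral01 k0 = Complex 0 (2 * pi) := wind.
have data j : (j < size s)%N -> exists d1 d2 : R -> R,
    let x := nth 0 (0 :: s) j in let y := nth 0 s j in
    [/\ `[x, y] `<=` `[0, last 0 s],
      path_continuous `[x, y] (fun t => Complex (d1 t) (d2 t)) &
      forall t : R, t \in `]x, y[ -> [/\ t \in `[(0 : R), 1],
        is_derive t 1 (fun s => Re (gam s)) (d1 t) &
        is_derive t 1 (fun s => Im (gam s)) (d2 t)]].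
  move=> js; have [[d1 [c1 D1]] [d2 [c2 D2]]] := pieces j js.
  have [x0 y1] := path_nth_bounds ps js.
  have sub : `[nth 0 (0 :: s) j, nth 0 s j] `<=` `[0, last 0 s].
    by apply: subset_itv; rewrite bnd_simp.
  exists d1, d2; split=> // t txy; split; [|exact: D1|exact: D2].
  rewrite -s1; apply: sub; rewrite /= in_itv /=.
  by move: txy; rewrite in_itv /= => /andP[/ltW -> /ltW ->].
have k0E (t d1 d2 : R) : is_derive t 1 (fun s => Re (gam s)) d1 ->
    is_derive t 1 (fun s => Im (gam s)) d2 -> k0 t = (gam t)^-1 * Complex d1 d2.
  by move=> D1 D2; rewrite /k0 -(derive_pathE D1 D2).
have kE (t d1 d2 : R) : t \in `[(0 : R), 1] -> is_derive t 1 (fun s => Re (gam s)) d1 ->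
    is_derive t 1 (fun s => Im (gam s)) d2 ->
    k t - c%:C%C * k0 t = q (gam t) * Complex d1 d2.
  move=> t01 D1 D2; rewrite (Hk _ _ _ t01 D1 D2) (k0E _ _ _ D1 D2).
  by rewrite mulrDl mulrA addrAC subrr add0r.
have ReE t : Re (k t) - c * Re (k0 t) = Re (k t - c%:C%C * k0 t).
  by case: (k t) (k0 t) => [? ?] [? ?] /=; rewrite mul0r subr0.
have ImE t : Im (k t) - c * Im (k0 t) = Im (k t - c%:C%C * k0 t).
  by case: (k t) (k0 t) => [? ?] [? ?] /=; rewrite mul0r addr0.
have IRe : (\int[mu]_(t in `[0%R, last 0%R s]) Re (k t) =
    c * \int[mu]_(t in `[0%R, last 0%R s]) Re (k0 t))%R.
  apply: (@Rintegral_modulo_primitive _ _ (fun t => Re (Q (gam t)))).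
  - split=> // j js; have [d1 [d2 [sub cd D]]] := data j js.
    exists (fun t => Re ((gam t)^-1 * Complex (d1 t) (d2 t))); split.
      by have [] := path_continuousM (path_continuousW sub cVg) cd.
    by move=> t /D[_ D1 D2]; rewrite (k0E _ _ _ D1 D2).
  - split=> // j js; have [d1 [d2 [sub cd D]]] := data j js.
    exists (fun t => Re (q (gam t) * Complex (d1 t) (d2 t))); split.
      by have [] := path_continuousM (path_continuousW sub cqg) cd.
    move=> t /D[t01 D1 D2]; rewrite ReE (kE _ _ _ t01 D1 D2); split=> //.
    by have [n0 nr] := itv01 t t01; exact: Re_cderiv_path (DQ _ n0 nr).
  - by case: cQg.
  - by rewrite s1 gam01.
have IIm : (\int[mu]_(t in `[0%R, last 0%R s]) Im (k t) =
    c * \int[mu]_(t in `[0%R, last 0%R s]) Im (k0 t))%R.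
  apply: (@Rintegral_modulo_primitive _ _ (fun t => Im (Q (gam t)))).
  - split=> // j js; have [d1 [d2 [sub cd D]]] := data j js.
    exists (fun t => Im ((gam t)^-1 * Complex (d1 t) (d2 t))); split.
      by have [] := path_continuousM (path_continuousW sub cVg) cd.
    by move=> t /D[_ D1 D2]; rewrite (k0E _ _ _ D1 D2).
  - split=> // j js; have [d1 [d2 [sub cd D]]] := data j js.
    exists (fun t => Im (q (gam t) * Complex (d1 t) (d2 t))); split.
      by have [] := path_continuousM (path_continuousW sub cqg) cd.
    move=> t /D[t01 D1 D2]; rewrite ImE (kE _ _ _ t01 D1 D2); split=> //.
    by have [n0 nr] := itv01 t t01; exact: Im_cderiv_path (DQ _ n0 nr).
  - by case: cQg.
  - by rewrite s1 gam01.
rewrite s1 in IRe IIm.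
rewrite -windE /integral01 IRe IIm.
by apply/eqP; rewrite eq_complex /= !mul0r subr0 addr0 !eqxx.
Qed.

End CurveIntegral.

(** * Primitives away from the residue *)

Section Principal.
Variable R : realType.
Implicit Types (a : nat -> R[i]) (z : R[i]).

(* Splitting off the term of degree [-1], [z^-(m+1)] times the derivative of
   the series of [a] has a primitive on the punctured disc. *)
Lemma pser_dcoef_primitive (C K : R) a m : 0 < K -> geometric_le C K a ->
  exists Q : R[i] -> R[i], forall z, z != 0 ->
    2%:R * K * normc z < 4%:R^-1 ->
    cderiv Q z (z ^- m.+1 * pser (dcoef a) z - (m.+1%:R * a m.+1) * z^-1).
Proof.
move=> K0 aC; set b := dcoef a; pose K' := 2%:R * K.
have K'0 : 0 < K' by rewrite mulr_gt0.
have bC : geometric_le (C * K) K' b := dcoef_geometric (ltW K0) aC.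
(* The term [b (m + k) z^(k - 1)] integrates to [h k z^k] for positive [k]. Division by zero makes
   [h 0 = 0], the integration constant; [b m] itself is the residue. *)
pose h k := b (m + k)%N / k%:R.
have hC : geometric_le (C * K * K' ^+ m) K' h.
  move=> k; rewrite Normc.normcM Normc.normcV normc_nat.
  have bk : normc (b (m + k)%N) <= C * K * K' ^+ m * K' ^+ k.
    by apply: le_trans (bC _) _; rewrite exprD mulrA.
  have rhs0 := le_trans (normc_ge0 _) bk.
  case: k bk rhs0 => [|k] bk rhs0; first by rewrite invr0 mulr0.
  rewrite ler_pdivrMr ?ltr0Sn //; apply: le_trans bk _.
  by rewrite ler_peMr // ler1n.
have dh k : dcoef h k = b (m.+1 + k)%N.
  by rewrite /dcoef /h mulrCA divff ?pnatr_eq0 // mulr1 addnS addSn.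
exists (fun z => \sum_(k < m) (b k * - (m - k)%:R^-1) * z ^- (m - k) + pser h z).
move=> z z0 Kz.
have -> : z ^- m.+1 * pser b z - m.+1%:R * a m.+1 / z =
  \sum_(k < m) (b k * - (m - k)%:R^-1) * (- (m - k)%:R * z ^- (m - k).+1) +
  pser (dcoef h) z.
  have bdom := pser_dominated (ltW K'0) bC (ltW Kz).
  have tail : csum (fun n => b (m.+1 + n)%N * z ^+ (m.+1 + n)) =
      z ^+ m.+1 * pser (dcoef h) z.
    have hdom : dominated (C * K * K' ^+ m.+1) (fun n => dcoef h n * z ^+ n).
      move=> n; rewrite dh Normc.normcM normcX.
      apply: le_trans (ler_wpM2r (exprn_ge0 _ (normc_ge0 _)) (bC _)) _.
      rewrite exprD mulrA -[leLHS]mulrA -exprMn ler_wpM2l //.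
        by rewrite mulr_ge0 ?exprn_ge0 ?(ltW K'0) ?(geometric_le_ge0 bC).
      rewrite -exprVn lerXn2r ?nnegrE ?mulr_ge0 ?normc_ge0 ?(ltW K0) //.
      by apply: le_trans (ltW Kz) _; lra.
    rewrite -(csumZ _ hdom); apply: eq_csum => n.
    by rewrite dh exprD mulrCA.
  rewrite {1}/pser (csum_split m.+1 bdom) tail mulrDr mulKf ?expf_neq0 //.
  rewrite /psum big_ord_recr /= mulrDr.
  have -> : z ^- m.+1 * (b m * z ^+ m) = m.+1%:R * a m.+1 / z.
    by rewrite /b /dcoef exprS; field; rewrite z0 expf_neq0.
  rewrite addrAC addrK mulr_sumr; congr (_ + _); apply: eq_bigr => k _.
  have mk : (m - k)%:R != 0 :> R[i] by rewrite pnatr_eq0 subn_eq0 -ltnNge.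
  rewrite -[m.+1](subnK (leqW (ltnW (ltn_ord k)))) subSn ?(ltnW (ltn_ord k)) //.
  by rewrite exprD; field; rewrite mk !expf_neq0.
apply: cderivD; last exact: (pser_cderiv K'0 hC Kz).
apply: (@cderiv_sum _ m (fun k => b k * - (m - k)%:R^-1) (fun k z => z ^- (m - k))
  (fun k => - (m - k)%:R * z ^- (m - k).+1)).
by move=> k; exact: cderivVX.
Qed.

End Principal.

(** * The generating functions *)

Section CatalanSeries.
Variables (R : realType) (G : digraph).
Hypotheses (G_irreducible : irreducible G) (G_edges : (2 <= #|edge G|)%N).
Hypothesis G_in : forall v : vertex G, exists e : edge G, tgt e = v.
Variables (O : cstarAlgType R) (S : edge G -> O).
Hypothesis S_CK : cuntz_krieger_family (@edge_matrix G) S.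
Variables (O' : cstarAlgType R) (S' : edge G -> O').
Hypothesis S'_cuntz : cuntz_family S'.

Definition growth : R := ((2 * #|edge G|) ^ 2)%:R.
Definition catalan_coef (v : vertex G) (n : nat) : R[i] := (gcatalan S S' n v)%:R.
Let K := growth.
Let a := catalan_coef.
Let f v := pser (a v).

Lemma growth_gt0 : 0 < growth.
Proof. by rewrite ltr0n expn_gt0 muln_gt0 (ltnW G_edges). Qed.

Lemma catalan_coef_le v : geometric_le 1 K (a v).
Proof.
move=> n; rewrite mul1r normc_nat -natrX ler_nat.
exact: gcatalan_le.
Qed.

Lemma catalan_coefS v n : a v n.+1 =
  \sum_(k < n.+1) (\sum_(e | tgt e == v) a (src e) k) * a v (n - k)%N.
Proof.
rewrite /a /catalan_coef gcatalanS // natr_sum; apply: eq_bigr => k _.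
rewrite natr_sum mulr_suml; apply: eq_bigr => e _.
by rewrite natrM.
Qed.

Lemma catalan_coef0 v : a v 0 = 1. Proof. by []. Qed.

Lemma catalan_series_eq v z : K * normc z <= 4%:R^-1 ->
  f v z = 1 + z * ((\sum_(e | tgt e == v) f (src e) z) * f v z).
Proof.
move=> Kz; have K0 := ltW growth_gt0.
have dom u := pser_dominated K0 (catalan_coef_le u) Kz.
have quarter u n := geometric_le_term n K0 (catalan_coef_le u) Kz.
rewrite [LHS](csum_split 1 (dom v)) /psum big_ord1 catalan_coef0 expr0 mulr1.
congr (1 + _).
have [sdom ssum] := csum_sum (index_enum (edge G)) (fun e => tgt e == v)
  (fun e => dom (src e)).
rewrite -[\sum_(e | _) f _ z]ssum mulrA -(csumZ z sdom).
pose C := normc z * \sum_(e : edge G | tgt e == v) (1 : R).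
(* The prefactor [z] joins the first factor of the Cauchy product and produces the shift from n to n
   + 1. *)
have sq n : normc (z * \sum_(e | tgt e == v) a (src e) n * z ^+ n) <= C / 4%:R ^+ n.
  rewrite Normc.normcM -mulrA ler_wpM2l ?normc_ge0 // mulr_suml.
  by apply: le_trans (ler_normc_sum _ _ _) _; apply: ler_sum => e _; exact: quarter.
rewrite (csumM sq (quarter v)); apply: eq_csum => n.
rewrite add1n catalan_coefS mulr_suml; apply: eq_bigr => k _.
have kn : (k <= n)%N by rewrite -ltnS.
have -> : z ^+ n.+1 = z * (z ^+ k * z ^+ (n - k)).
  by rewrite -exprD subnKC // exprS.
by rewrite -mulr_suml; ring.
Qed.

(** Without its constant term the series starts with a term of size at most 1/4, which [csum_le]
    doubles. The point is that [f v z] has positive real part. *)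
Lemma catalan_series_near1 v z : K * normc z <= 4%:R^-1 ->
  normc (f v z - 1) <= 2%:R^-1.
Proof.
move=> Kz; have K0 := ltW growth_gt0.
have dom := pser_dominated K0 (catalan_coef_le v) Kz.
rewrite [f v z](csum_split 1 dom) /psum big_ord1 catalan_coef0 expr0 mulr1.
rewrite addrC addKr.
have -> : 2%:R^-1 = 2%:R * 4%:R^-1 :> R by lra.
apply: csum_le => n; apply: le_trans (geometric_le_term _ K0 (catalan_coef_le v) Kz) _.
rewrite add1n exprS invfM mul1r ler_wpM2l ?invr_ge0 //.
by rewrite -[leLHS]mul1r -[leRHS]mul1r le_quarter_half.
Qed.

Lemma catalan_map_series j z :
  catalan_map j (fun i => f i z - 1) = f j z * \sum_(e | tgt e == j) f (src e) z.
Proof.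
rewrite /catalan_map subrK; congr (_ * _).
rewrite (partition_big (@src G) predT) //=; apply: eq_bigr => u _.
rewrite subrK /vertex_matrix.
rewrite (eq_bigr (fun=> f u z)); last by move=> e /andP[_ /eqP ->].
rewrite sumr_const -[RHS]mulr_natl; congr (_%:R * _); apply: eq_card => e.
by rewrite !inE andbC.
Qed.

(** [w_j = z F_j(w)] makes the quotient the same for all [j], once [F] is nonzero. If [F] were 0,
    then [f_j] would be 1 and [F] a nonempty sum of numbers with positive real part. *)
Lemma catalan_ratio j z n : K * normc z <= 4%:R^-1 -> z != 0 ->
  catalan_map j (fun i => f i z - 1) ^+ n / (f j z - 1) ^+ n = z ^- n.
Proof.
move=> Kz z0; set F := catalan_map _ _.
have wE : f j z - 1 = z * F.
  by rewrite /F catalan_map_series {1}catalan_series_eq // addrC addKr [f j z * _]mulrC.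
have Re_gt0 v : 0 < complex.Re (f v z).
  have := le_trans (ler_Re_normc _) (catalan_series_near1 v Kz).
  by rewrite raddfB /= ler_norml => /andP[+ _]; lra.
have F0 : F != 0.
  apply/negP => /eqP F0; have := F0; rewrite /F catalan_map_series.
  have fj : f j z = 1 by apply/eqP; rewrite -subr_eq0 wE F0 mulr0.
  rewrite fj mul1r => /(congr1 (@complex.Re R)); rewrite raddf_sum /=.
  have [e ej] := G_in j.
  rewrite (bigD1 e) ?ej //= => /eqP; rewrite gt_eqF // ltr_pwDl //.
  by apply: sumr_ge0 => e' _; exact: ltW.
by rewrite wE -expr_div_n invfM mulrCA divff // mulr1 exprVn.
Qed.

End CatalanSeries.

Theorem theorem8p1 (R : realType) (G : digraph)
  (G_irreducible : irreducible G)
  (G_in : forall v : vertex G, exists e : edge G, tgt e = v)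
  (G_out : forall v : vertex G, exists e : edge G, src e = v)
  (G_edges : (2 <= #|edge G|)%N)
  (O : cstarAlgType R) (S : edge G -> O)
  (O_CK : is_cuntz_krieger_algebra (@edge_matrix G) S)
  (O' : cstarAlgType R) (S' : edge G -> O')
  (O'_cuntz : is_cuntz_algebra S') :
  let w (i : vertex G) (z : R[i]) : R[i] := gcatalan_series S S' i z - 1 in
  exists2 r : R, 0 < r &
    forall gam : R -> R[i], small_loop_around0 r gam ->
    forall (n : nat) (i j : vertex G), (1 <= n)%N ->
      (gcatalan S S' n i)%:R =
        (Complex 0 (2 * pi) * n%:R)^-1 *
        curve_integral gam
          (fun z => catalan_map j (w ^~ z) ^+ n / w j z ^+ n) (w i)
      /\
      (gcatalan S S' n i)%:R =
        (Complex 0 (2 * pi) * n%:R)^-1 *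
        curve_integral gam
          (fun z => catalan_map j (w ^~ z) ^+ n / w j z ^+ n
                    * deriveC (w i) z) id.
Proof.
have [S_CK _ _] := O_CK; have [S'_cuntz _ _] := O'_cuntz.
move=> w; pose K : R := growth R G; pose a := catalan_coef S S'.
have K0 : 0 < K := growth_gt0 R G_edges.
have wE i z : w i z = pser (a i) z - 1 by [].
(* On this disc the derived series, with growth constant [2 K], still satisfies its bound 1/4. *)
exists (8%:R * K)^-1; first by rewrite invr_gt0 mulr_gt0.
move=> gam loop [|m] i j // _.
have small z : normc z < (8%:R * K)^-1 -> 2%:R * K * normc z < 4%:R^-1.
  by rewrite invfM ltr_pdivlMr // => H; lra.
have small1 z : normc z < (8%:R * K)^-1 -> K * normc z < 4%:R^-1.
  move/small; have := mulr_ge0 (ltW K0) (normc_ge0 z); lra.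
have aC := catalan_coef_le G_irreducible G_edges S_CK S'_cuntz i.
have [Q HQ] := pser_dcoef_primitive m K0 aC.
(* The residue [n c_n] of [w_i' z^-n] at 0, with [n = m + 1]; the prefactor 1/n of the formula
   cancels n. *)
pose c : R := m.+1%:R * (gcatalan S S' m.+1 i)%:R.
have cE : c%:C%C = m.+1%:R * a i m.+1 by rewrite rmorphM !rmorph_nat.
pose q z := z ^- m.+1 * pser (dcoef (a i)) z - c%:C%C * z^-1.
have DQ z : z != 0 -> normc z < (8%:R * K)^-1 -> cderiv Q z (q z).
  by move=> z0 /small zr; rewrite /q cE; exact: HQ.
have Dq z : z != 0 -> normc z < (8%:R * K)^-1 -> exists l, cderiv q z l.
  move=> z0 /small zr.
  have K20 : 0 < 2%:R * K by rewrite mulr_gt0.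
  have d1 := pser_cderiv K20 (dcoef_geometric (ltW K0) aC) zr.
  have d2 := cderivM (cderivVX m.+1 z0) d1.
  have := cderivD d2 (cderivZ (- c%:C%C) (cderivV z0)).
  under [X in cderiv X]eq_fun do rewrite mulNr.
  by eexists; eassumption.
have Dw z : normc z < (8%:R * K)^-1 -> cderiv (w i) z (pser (dcoef (a i)) z).
  move=> /small1 zr; rewrite -[pser _ z]addr0.
  exact: (cderivD (pser_cderiv K0 aC zr) (cderiv_cst (- 1) z)).
have ratio z : z != 0 -> normc z < (8%:R * K)^-1 ->
    catalan_map j (w ^~ z) ^+ m.+1 / w j z ^+ m.+1 = z ^- m.+1.
  move=> z0 /small1/ltW zr.
  exact: (catalan_ratio G_irreducible G_edges G_in S_CK S'_cuntz).
have [_ _ [gam0 _] gamr] := loop.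
have final k : integral01 k = c%:C%C * Complex 0 (2 * pi) ->
    (gcatalan S S' m.+1 i)%:R = (Complex 0 (2 * pi) * m.+1%:R)^-1 * integral01 k.
  move=> ->; rewrite cE.
  have pi0 : Complex 0 (2 * pi) != 0 :> R[i].
    by rewrite eq_complex /= negb_and mulf_neq0 ?orbT ?pnatr_eq0 ?gt_eqF ?pi_gt0.
  rewrite -/(a i m.+1); field.
  by rewrite pi0 nat1r pnatr_eq0.
(* At the smooth points of the curve the chain rule identifies the two integrands, so one residue
   computation serves both. *)
split; apply: final; apply: (integral01_residue loop DQ Dq) => t d1 d2 t01 D1 D2.
  have z0 := gam0 t t01; have zr := gamr t t01.
  rewrite ratio // (derive_path_comp D1 D2 (Dw _ zr)) mulrA.
  by rewrite /q addrC subrK.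
have z0 := gam0 t t01; have zr := gamr t t01.
rewrite ratio // (deriveCE (Dw _ zr)) -(derive_pathE D1 D2).
by rewrite /q addrC subrK.
Qed.
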